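(* Let $\eta=(\eta(t))_{t\ge0}$ be a non-decreasing càdlàg process with $\eta(0)=0$, which is stochastically continuous, and let $L=(L(t))_{t\ge0}$ be a subordinator (independent of $\eta$) whose Laplace transform is $$\mathbb E[e^{-xL(1)}]=\exp\Big\{-\gamma x+\int_{(0,\infty)}(e^{-xv}-1)\,\nu(dv)\Big\},\quad x\ge0,$$ with $\gamma\ge0$ and $\int_{(0,\infty)}(1\wedge s)\,\nu(ds)<\infty$. Then the time changed Lévy process $N(t):=L(\eta(t))$ has (i) independent increments if and only if $\eta$ has independent increments; (ii) stationary independent increments if and only if $\eta$ is a subordinator.
   Context: A subordinator is a non-decreasing Lévy process: a càdlàg, stochastically continuous, non-decreasing process starting at $0$ a.s. with stationary and independent increments (a drift $\gamma\ge0$ being allowed); $\nu$ is its Lévy measure on $(0,\infty)$.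
   Formalization: The formal theorem additionally assumes that L is not the zero process (not both γ = 0 and ν = 0); otherwise N = 0 a.s. has stationary independent increments for every η, e.g. η(t) = ξt with ξ ≥ 0 non-constant, and both equivalences fail. *)

(* Defs.v *)
From HB Require Import structures.
From mathcomp Require Import all_boot all_order all_algebra.
From mathcomp Require Import all_classical all_reals all_analysis.
From mathcomp Require Import measurable_realfun.

Set Implicit Arguments.
Unset Strict Implicit.
Unset Printing Implicit Defensive.

Import Order.TTheory GRing.Theory Num.Theory.
Import numFieldNormedType.Exports.

Local Open Scope classical_set_scope.
Local Open Scope ring_scope.

(* A process (X(t))_{t >= 0} is a function X : R -> T -> R of time and omega;
   its values at negative times are irrelevant and never constrained. *)

Section processes.
Context {d : measure_display} {T : measurableType d} {R : realType}.
Variable P : probability T R.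
Implicit Types X Y : R -> T -> R.

Definition nondecreasing_paths X : Prop :=
  forall (w : T) (s t : R), 0 <= s -> s <= t -> X s w <= X t w.

Definition cadlag X : Prop :=
  forall (w : T) (t : R),
    (0 <= t -> X s w @[s --> t^'+] --> X t w) /\
    (0 < t -> cvg (X s w @[s --> t^'-])).

Definition stochastically_continuous X : Prop :=
  forall t e : R, 0 <= t -> 0 < e ->
    P [set w | e < `|X s w - X t w|]
      @[s --> within [set s : R | 0 <= s] (nbhs t)] --> (0 : \bar R).

(* Taking B i = setT for some of the i gives the product rule for all
   subfamilies. *)
Definition mutually_independent (I : finType) (Y : I -> T -> R) : Prop :=
  forall B : I -> set R, (forall i, measurable (B i)) ->
    P (\bigcap_(i in [set: I]) (Y i @^-1` B i)) =
    (\prod_(i in I) P (Y i @^-1` B i))%E.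

Definition independent_increments X : Prop :=
  forall (n : nat) (t : nat -> R),
    0 <= t 0%N -> (forall i, (i < n)%N -> t i < t i.+1) ->
    mutually_independent (fun (i : 'I_n) w => X (t i.+1) w - X (t i) w).

Definition stationary_increments X : Prop :=
  forall (s h : R) (B : set R), 0 <= s -> 0 <= h -> measurable B ->
    P [set w | B (X (s + h) w - X s w)] = P [set w | B (X h w - X 0 w)].

Definition subordinator X : Prop :=
  [/\ cadlag X, stochastically_continuous X, nondecreasing_paths X,
      {ae P, forall w, X 0 w = 0} &
      stationary_increments X /\ independent_increments X].

(* sigma(X(t) : t >= 0) *)
Definition sigma_process X : set (set T) :=
  <<s [set A | exists t (B : set R),
         [/\ 0 <= t, measurable B & A = X t @^-1` B] ] >>.

Definition independent_processes X Y : Prop :=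
  forall A B : set T, sigma_process X A -> sigma_process Y B ->
    P (A `&` B) = (P A * P B)%E.

Definition time_change X Y : R -> T -> R := fun t w => X (Y t w) w.

End processes.

(* The probabilities in the definitions above are only meaningful for measurable
   processes; right-continuity of X makes the time-changed process one. *)
Lemma measurable_time_change (d : measure_display) (T : measurableType d)
    (R : realType) (X Y : R -> T -> R) (t : R) :
  (forall s, 0 <= s -> measurable_fun setT (X s)) ->
  measurable_fun setT (Y t) -> (forall w, 0 <= Y t w) ->
  cadlag X -> measurable_fun setT (time_change X Y t).
Proof.
move=> mX mY Y0 cX.
pose k n w := (Num.truncn (n.+1%:R * Y t w)).+1.
apply: (@measurable_fun_cvg _ _ _ setT
  (fun n w => X ((k n w)%:R / n.+1%:R) w)) => [n|w _].
- move=> _ B mB; rewrite setTI.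
  have -> : (fun w => X ((k n w)%:R / n.+1%:R) w) @^-1` B =
      \bigcup_i ([set w | i%:R <= n.+1%:R * Y t w < i.+1%:R] `&`
        (X (i.+1%:R / n.+1%:R) @^-1` B)).
    apply/seteqP; split=> w /=.
      move=> Bw; exists (Num.truncn (n.+1%:R * Y t w)) => //; split=> //.
      by apply: truncn_itv; rewrite mulr_ge0.
    by case=> i _ [/= /truncn_def iE]; rewrite /k iE.
  apply: bigcupT_measurable => i; apply: measurableI.
    have m1 : measurable_fun setT (fun w => n.+1%:R * Y t w).
      exact: measurable_funM (measurable_cst _) mY.
    rewrite [X in measurable X](_ : _ = (fun w => n.+1%:R * Y t w) @^-1`
      `[i%:R, i.+1%:R[).
      by rewrite -[X in measurable X]setTI; exact: m1.
    by apply/seteqP; split=> w /=; rewrite in_itv.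
  by rewrite -[X in measurable X]setTI; apply: mX.
- have [/(_ (Y0 w)) rc _] := cX w (Y t w).
  move/cvg_at_rightP : rc => /(_ (fun n => (k n w)%:R / n.+1%:R)); apply.
  have kb n : Y t w < (k n w)%:R / n.+1%:R <= Y t w + harmonic n.
    have /andP[k1 k2] : (Num.truncn (n.+1%:R * Y t w))%:R <= n.+1%:R * Y t w <
        (Num.truncn (n.+1%:R * Y t w)).+1%:R.
      by apply: truncn_itv; rewrite mulr_ge0.
    rewrite ltr_pdivlMr// mulrC k2/= ler_pdivrMr// mulrDl mulVf//.
    by rewrite /k -(natr1 (Num.truncn _)) lerD2r [leRHS]mulrC.
  split=> [n|]; first by have /andP[] := kb n.
  apply: (@squeeze_cvgr _ _ _ _ (cst (Y t w)) (fun n => Y t w + harmonic n)).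
  + by near=> n; have /andP[/ltW-> ->] := kb n.
  + exact: cvg_cst.
  + by rewrite -[X in _ --> X]addr0; apply: cvgD;
      [exact: cvg_cst|exact: cvg_harmonic].
Unshelve. all: by end_near. Qed.

(* Main.v *)
(* Let phi be the Laplace exponent of L. Conditioning on eta shows that the
   joint Laplace transform of the increments of N at (x_i) equals that of the
   increments of eta at (phi (x_i)); eta is approximated from the right by grid
   valued times, so that only finite sums occur. As phi is continuous and
   nonzero, it takes all values in [0, phi 1], but it may be bounded. A Laplace
   transform is however determined by its values on [0, c] for any c > 0:
   the functions f for which E[f(Z) W] = E[f(Z') W'] form a vector space closed
   under bounded pointwise limits, and such a space containing exp(-y z) for
   y in [0, c] contains all indicators of Borel sets. Independence of the
   increments and equality of their laws thus pass between N and eta. *)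

Require Import Defs.
From HB Require Import structures.
From mathcomp Require Import all_boot all_order all_algebra.
From mathcomp Require Import all_classical all_reals all_analysis.
From mathcomp Require Import measurable_realfun.
From mathcomp Require Import ring lra.

Set Implicit Arguments.
Unset Strict Implicit.
Unset Printing Implicit Defensive.

Import Order.TTheory GRing.Theory Num.Theory.
Import numFieldNormedType.Exports.

Local Open Scope classical_set_scope.
Local Open Scope ring_scope.

(** * Spaces of functions closed under bounded pointwise limits *)

(** The exponentials [expm y] with y in [0, c] are not stable under products, so no multiplicative
    class argument applies to them directly. Differentiation in y produces z^k e^{-az}, a Taylor
    series then enlarges the interval of exponents by the factor 3/2, and repetition reaches all y
    >= 0, where products of exponentials are available. Joint laws need no multivariate version of
    this: one test function is exchanged at a time, the other factors being kept as a bounded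
    weight. Conditioning on [eta] rests on nothing but the product rule for events: on a cell where
    the grid indices of [eta] are fixed, the times put into L are constants. The case gamma = 0 with
    nu null on ]0, +oo[ has to be excluded, since N then vanishes almost surely whatever [eta] is;
    the exclusion enters as 0 < phi 1. *)

Section exp_series.
Context {R : realType}.
Implicit Types x : R.

Lemma cvg_series_exp_coeff x : series (exp_coeff x) @ \oo --> expR x.
Proof. exact: is_cvg_series_exp_coeff. Qed.

Lemma cvg_expR (u : nat -> R) x :
  u n @[n --> \oo] --> x -> expR (u n) @[n --> \oo] --> expR x.
Proof. by move=> ux; exact: (continuous_cvg _ (@continuous_expR R x) ux). Qed.

Lemma series_exp_coeff_le_expR x n : 0 <= x -> series (exp_coeff x) n <= expR x.
Proof.
move=> x0; apply: nondecreasing_cvgn_le; last exact: is_cvg_series_exp_coeff.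
apply/nondecreasing_seqP => k.
by rewrite /series/= big_nat_recr//= lerDl exp_coeff_ge0.
Qed.

Lemma normr_series_exp_coeff_le x n :
  `|series (exp_coeff x) n| <= expR `|x|.
Proof.
apply: le_trans (series_exp_coeff_le_expR n (normr_ge0 x)).
rewrite /series/=; apply: le_trans (ler_norm_sum _ _ _) _.
by apply: ler_sum => i _; rewrite /exp_coeff/= normrM normrX normfV normr_nat.
Qed.

Lemma exp_coeff_le_expR x n : 0 <= x -> x ^+ n / n`!%:R <= expR x.
Proof.
move=> x0; apply: le_trans (series_exp_coeff_le_expR n.+1 x0).
rewrite /series/= big_nat_recr//= lerDr sumr_ge0// => i _.
exact: exp_coeff_ge0.
Qed.

(** The lower bound is crude, but only the first order at 0 matters: for x = h z, division by h
    leaves an error h z^2. *)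
Lemma expRN_bounds x : 0 <= x -> x - x ^+ 2 <= 1 - expR (- x) <= x.
Proof.
move=> x0; have := expR_ge1Dx x; have := expR_ge1Dx (- x).
have := expR_gt0 x; rewrite expRN => e0 h1 h2.
have h : expR x * (expR x)^-1 = 1 by rewrite mulfV// gt_eqF.
have e1 : 0 < (expR x)^-1 by rewrite invr_gt0.
nra.
Qed.

End exp_series.

Section bounded_pointwise_closure.
Context {R : realType}.
Implicit Types (H : set (R -> R)) (f g : R -> R).

Definition expm (y z : R) : R := expR (- (y * z)).

(* Bounds and limits are only required on [0, +oo[, where increments live. *)
Definition bp_closed H :=
  (forall a f g, H f -> H g -> H (fun z => a * f z + g z)) /\
  (forall (f_ : nat -> R -> R) f (M : R), measurable_fun setT f ->
    (forall n, H (f_ n)) ->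
    (forall n z, 0 <= z -> `|f_ n z| <= M) ->
    (forall z, 0 <= z -> f_ n z @[n --> \oo] --> f z) -> H f).

Lemma measurable_expm y : measurable_fun setT (expm y).
Proof.
apply: measurableT_comp => //; apply: measurableT_comp => //.
Qed.

Lemma expm_ge0 y z : 0 <= expm y z. Proof. exact: expR_ge0. Qed.

Lemma expm_le1 y z : 0 <= y -> 0 <= z -> expm y z <= 1.
Proof. by move=> y0 z0; rewrite /expm -expR0 ler_expR oppr_le0 mulr_ge0. Qed.

Lemma expmD a b z : expm (a + b) z = expm a z * expm b z.
Proof. by rewrite /expm mulrDl opprD expRD. Qed.

Lemma bp_closed_sum H n (a : nat -> R) (f : nat -> R -> R) : bp_closed H ->
  (forall i, H (f i)) -> H (fun z => \sum_(0 <= i < n) a i * f i z).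
Proof.
move=> [lin _] Hf; elim: n => [|n IH].
  (* [bp_closed] does not postulate the zero function; it arises as - f + f. *)
  rewrite (_ : (fun _ => _) = (fun z => -1 * f 0%N z + f 0%N z)); first exact: lin.
  by apply/funext => z; rewrite big_nil; ring.
rewrite (_ : (fun _ => _) =
    (fun z => a n * f n z + \sum_(0 <= i < n) a i * f i z)); first exact: lin.
by apply/funext => z; rewrite big_nat_recr//= addrC.
Qed.

Section laplace_extension.
Variables (H : set (R -> R)) (Hbp : bp_closed H).

(** Induction on k: minus the difference quotient in a of z^k e^{-az} tends to z^(k+1) e^{-az}.
    Staying strictly inside ]0, c[ leaves room for the increment and keeps everything bounded on [0,
    +oo[, by (k+1)!/a^(k+1). *)
Lemma bp_closed_monomial_expm c : 0 < c ->
  (forall y, 0 <= y <= c -> H (expm y)) ->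
  forall k a, 0 < a < c -> H (fun z => z ^+ k * expm a z).
Proof.
have [lin lim] := Hbp => c0 Hc; elim=> [|k IH] a /andP[a0 ac].
  rewrite (_ : (fun _ => _) = expm a); first by apply: Hc; rewrite !ltW.
  by apply/funext => z; rewrite expr0 mul1r.
(* The denominator n + 2 instead of n + 1 keeps a + h n strictly below c already at n = 0. *)
pose h (n : nat) : R := (c - a) / n.+2%:R.
have h0 n : 0 < h n by rewrite divr_gt0// subr_gt0.
have hc n : a + h n < c.
  rewrite -ltrBrDl /h ltr_pdivrMr// ltr_pMr ?subr_gt0//.
  by rewrite (ltr_nat _ 1%N).
pose f_ n z := (- (h n)^-1) * (z ^+ k * expm (a + h n) z) +
               ((h n)^-1 * (z ^+ k * expm a z) + 0 * (z ^+ k * expm a z)).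
have fE n z : f_ n z = z ^+ k * expm a z * ((h n)^-1 * (1 - expR (- (h n * z)))).
  by rewrite /f_ expmD /expm; ring.
have fb n z : 0 <= z -> z - h n * z ^+ 2 <= (h n)^-1 * (1 - expR (- (h n * z))) <= z.
  move=> z0; have /andP[l u] := expRN_bounds (mulr_ge0 (ltW (h0 n)) z0).
  rewrite ler_pdivlMl// ler_pdivrMl// u andbT.
  by apply: le_trans l; rewrite le_eqVlt; apply/orP; left; apply/eqP; ring.
apply: (lim f_ _ (k.+1`!%:R / a ^+ k.+1)).
- by apply: measurable_funM; [exact: exprn_measurable|exact: measurable_expm].
- move=> n; apply: (lin); first by apply: IH; rewrite hc andbT addr_gt0.
  have Ha : H (fun z => z ^+ k * expm a z) by apply: IH; rewrite a0.
  rewrite [X in H X](_ : _ = (fun z => ((h n)^-1 - 1) * (z ^+ k * expm a z) +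
    z ^+ k * expm a z)); first exact: lin.
  by apply/funext => z; ring.
- move=> n z z0; rewrite fE; have /andP[_ u] := fb n z z0.
  have l : 0 <= (h n)^-1 * (1 - expR (- (h n * z))).
    rewrite mulr_ge0 ?invr_ge0 ?(ltW (h0 n))// subr_ge0 -expR0 ler_expR.
    by rewrite oppr_le0 mulr_ge0// ltW.
  rewrite ger0_norm; last first.
    by apply: mulr_ge0 => //; rewrite mulr_ge0 ?exprn_ge0 ?expm_ge0.
  rewrite ler_pdivlMr ?exprn_gt0//.
  apply: (@le_trans _ _ (z ^+ k * expm a z * z * a ^+ k.+1)).
    apply: ler_wpM2r; first by rewrite exprn_ge0// ltW.
    by apply: ler_wpM2l => //; rewrite mulr_ge0 ?exprn_ge0 ?expm_ge0.
  have := @exp_coeff_le_expR R (a * z) k.+1 (mulr_ge0 (ltW a0) z0).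
  rewrite ler_pdivrMr ?ltr0n ?fact_gt0// => hh.
  rewrite (_ : _ * _ = expm a z * (a * z) ^+ k.+1); last first.
    by rewrite exprMn !exprSr; ring.
  by rewrite /expm expRN ler_pdivrMl ?expR_gt0.
- move=> z z0; under eq_fun do rewrite fE.
  rewrite exprSr mulrAC; apply: cvgM; first exact: cvg_cst.
  have hl : h n @[n --> \oo] --> 0.
    rewrite -(mulr0 (c - a)); apply: cvgM; first exact: cvg_cst.
    by rewrite (cvg_shiftS (@harmonic R)); exact: cvg_harmonic.
  apply: (@squeeze_cvgr _ _ _ _ (fun n => z - h n * z ^+ 2) (cst z)).
  + by near=> n; exact: fb.
  + rewrite -[X in _ --> X]subr0 -[X in _ - X](mul0r (z ^+ 2)).
    by apply: cvgB; [exact: cvg_cst|apply: cvgM => //; exact: cvg_cst].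
  + exact: cvg_cst.
Unshelve. all: by end_near. Qed.

(* Taylor expansion at [3c/4], valid on the disc of radius [3c/4]. *)
Lemma bp_closed_expm_step c : 0 < c ->
  (forall y, 0 <= y <= c -> H (expm y)) ->
  forall y, 0 <= y <= 3 / 2 * c -> H (expm y).
Proof.
have [lin lim] := Hbp => c0 Hc y /andP[y0 yc].
(* Any centre strictly between c/2 and c would give a gain: the monomials need a < c, and the disc
   of radius a reaches 2a > c. *)
pose a := 3 / 4 * c; pose b := a - y.
have a0 : 0 < a by rewrite /a; nra.
have ac : a < c by rewrite /a; nra.
have ba : `|b| <= a by rewrite ler_norml /b /a; apply/andP; split; lra.
have -> : expm y = fun z => expm a z * expR (b * z).
  by apply/funext => z; rewrite /expm -expRD; congr expR; rewrite /b; ring.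
have Hmon := bp_closed_monomial_expm c0 Hc.
apply: (lim (fun n z => \sum_(0 <= k < n)
    (b ^+ k / k`!%:R) * (z ^+ k * expm a z)) _ 1).
- apply: measurable_funM; first exact: measurable_expm.
  by apply: measurableT_comp => //; exact: measurable_funM.
- by move=> n; apply: bp_closed_sum => // i; apply: Hmon; rewrite a0.
(* As |b| <= a, the factor e^{-az} absorbs e^{|b|z}, which dominates every partial sum. *)
- move=> n z z0.
  rewrite (_ : \sum_(_ <= _ < _) _ = expm a z * series (exp_coeff (b * z)) n).
    rewrite normrM ger0_norm ?expm_ge0//.
    apply: le_trans (_ : expm a z * expR `|b * z| <= 1).
      by rewrite ler_wpM2l ?expm_ge0// normr_series_exp_coeff_le.
    rewrite /expm -expRD -expR0 ler_expR normrM (ger0_norm z0).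
    by rewrite addrC subr_le0 ler_wpM2r.
  rewrite /series/= mulr_sumr; apply: eq_bigr => i _.
  by rewrite /exp_coeff/= exprMn; ring.
- move=> z z0.
  rewrite (_ : (fun _ => _) = (fun n => expm a z * series (exp_coeff (b * z)) n)).
    by apply: cvgM; [exact: cvg_cst|exact: cvg_series_exp_coeff].
  apply/funext => n; rewrite /series/= mulr_sumr; apply: eq_bigr => i _.
  by rewrite /exp_coeff/= exprMn; ring.
Qed.

Lemma bp_closed_expm c : 0 < c ->
  (forall y, 0 <= y <= c -> H (expm y)) -> forall y, 0 <= y -> H (expm y).
Proof.
move=> c0 Hc y y0.
have Hn n : forall y, 0 <= y <= (3 / 2) ^+ n * c -> H (expm y).
  elim: n => [|n IH]; first by move=> x; rewrite expr0 mul1r; exact: Hc.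
  move=> x xc; apply: (bp_closed_expm_step _ IH).
    by rewrite mulr_gt0// exprn_gt0//; lra.
  by rewrite mulrA -exprS.
(* Bernoulli's inequality gives an explicit number of enlargements after which y is covered. *)
have bern n : 1 + n%:R / 2 <= (3 / 2 : R) ^+ n.
  elim: n => [|n IH]; first by rewrite expr0; lra.
  by rewrite exprS -natr1; have := ler0n R n; nra.
pose n := Num.truncn (2 * (y / c)).
apply: (Hn n.+1); rewrite y0/= -ler_pdivrMr//.
apply: le_trans (bern n.+1).
have : 2 * (y / c) < n.+1%:R by apply: truncnS_gt.
lra.
Qed.

Hypothesis Hexp : forall y, 0 <= y -> H (expm y).

(** Expand in powers of e^{-tz}: the k-th power is the exponential with exponent k t, which lies in
    H now that exponents are unrestricted. As e^{-tz} <= 1 on the half-line, the partial sums stay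
    below e^l. *)
Lemma bp_closed_gumbel l t : 0 <= l -> 0 <= t ->
  H (fun z => expR (- (l * expm t z))).
Proof.
have [lin lim] := Hbp => l0 t0.
have E n z : \sum_(0 <= k < n) ((- l) ^+ k / k`!%:R) * expm (k%:R * t) z =
    series (exp_coeff (- (l * expm t z))) n.
  rewrite /series/=; apply: eq_bigr => k _.
  rewrite /exp_coeff/= -mulNr exprMn mulrAC; congr (_ * _ / _).
  by rewrite /expm -expRM_natl; congr expR; ring.
apply: (lim (fun n z => \sum_(0 <= k < n) ((- l) ^+ k / k`!%:R) *
    expm (k%:R * t) z) _ (expR l)).
- apply: measurableT_comp => //; apply: measurableT_comp => //.
  by apply: measurable_funM => //; exact: measurable_expm.
- by move=> n; apply: bp_closed_sum => // i; apply: Hexp; rewrite mulr_ge0.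
- move=> n z z0; rewrite E; apply: le_trans (normr_series_exp_coeff_le _ _) _.
  rewrite ler_expR normrN normrM ger0_norm// ger0_norm ?expm_ge0//.
  by rewrite ler_piMr// expm_le1.
- by move=> z z0; under eq_fun do rewrite E; exact: cvg_series_exp_coeff.
Qed.

Lemma cvg_expRN_seq (u : nat -> R) : (forall n : nat, n%:R <= u n) ->
  expR (- u n) @[n --> \oo] --> (0 : R).
Proof.
move=> nu; apply: (@squeeze_cvgr _ _ _ _ (cst 0) (fun n : nat => n.+1%:R^-1)).
- near=> n; rewrite expR_ge0/= expRN lef_pV2 ?posrE ?expR_gt0 ?ltr0n//.
  by have := expR_ge1Dx (u n); have := nu n; rewrite -natr1; lra.
- exact: cvg_cst.
- exact: cvg_harmonic.
Unshelve. all: by end_near. Qed.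

(* The Gumbel-type kernels [exp(-e^(n^2(x - z) - n))] increase sharply from 0
   to 1 as [z] crosses [x]; the extra [- n] fixes the limit at [z = x]. *)
Lemma bp_closed_indic_ray x : H (\1_(`[x, +oo[%classic)).
Proof.
have [lin lim] := Hbp.
pose f_ (n : nat) z := expR (- (expR (n%:R ^+ 2 * x - n%:R) * expm (n%:R ^+ 2) z)).
have fE n z : f_ n z = expR (- expR (n%:R ^+ 2 * (x - z) - n%:R)).
  by rewrite /f_ /expm -expRD; congr (expR (- expR _)); ring.
apply: (lim f_ _ 1).
- exact: measurable_indic.
- by move=> n; apply: bp_closed_gumbel; rewrite ?expR_ge0// sqr_ge0.
- move=> n z _; rewrite /f_ ger0_norm ?expR_ge0// -expR0 ler_expR oppr_le0.
  by rewrite mulr_ge0 ?expR_ge0 ?expm_ge0.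
- move=> z z0; under eq_fun do rewrite fE.
  have [xz|zx] := leP x z.
    rewrite indicE mem_set/=; last by rewrite in_itv/= xz.
    pose u (n : nat) := n%:R ^+ 2 * (z - x) + n%:R.
    have uE n : n%:R ^+ 2 * (x - z) - n%:R = - u n by rewrite /u; ring.
    under eq_fun do rewrite uE.
    have un n : n%:R <= u n by rewrite lerDr mulr_ge0 ?sqr_ge0 ?subr_ge0.
    by have /cvgN/cvg_expR := cvg_expRN_seq un; rewrite oppr0 expR0.
  rewrite indicE memNset/=; last first.
    by rewrite in_itv/= andbT; apply/negP; rewrite -ltNge.
  have d0 : 0 < x - z by rewrite subr_gt0.
  (* For m >= N one has m (x - z) >= 2, so that m^2 (x - z) - m >= m. *)
  pose N := (Num.truncn (2 / (x - z))).+1.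
  suff : expR (- expR (n%:R ^+ 2 * (x - z) - n%:R)) @[n --> \oo] --> (0 : R) by [].
  rewrite -(cvg_shiftn N).
  apply: cvg_expRN_seq => n.
  have : 2 / (x - z) < N%:R by apply: truncnS_gt.
  rewrite ltr_pdivrMr// => hN.
  apply: le_trans (expR_ge1Dx _); rewrite natrD.
  have n0 := ler0n R n; have : 2 <= (n%:R + N%:R) * (x - z) by nra.
  by have := ler0n R N; nra.
Qed.

End laplace_extension.
End bounded_pointwise_closure.

Section indicators.
Context {R : realType}.
Variables (H : set (R -> R)) (Hbp : bp_closed H).

(** Dynkin's argument: rays are stable under intersection and generate the Borel sets, and the sets
    with indicator in H form a lambda-system, proper differences being linear combinations and
    increasing unions bounded limits. *)
Lemma bp_closed_indic_measurable :
  (forall x, H (\1_(`[x, +oo[%classic))) ->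
  forall B : set R, measurable B -> H (\1_B).
Proof.
have [lin lim] := Hbp => Hray.
pose D := [set B : set R | measurable B /\ H (\1_B)].
suff DE : measurable `<=` D by move=> B /DE[].
change ((@ocitv R).-sigma.-measurable `<=` D).
rewrite RGenCInfty.measurableE.
apply: lambda_system_subset => //.
- move=> _ _ [x ->] [y ->]; exists (Num.max x y).
  apply/seteqP; split=> z /=; rewrite !in_itv/= !andbT ge_max.
    by move=> [-> ->].
  by move/andP.
- split => //.
  (* On the half-line, where limits are tested, the ray from 0 has the same indicator as the whole
     line; a constant sequence suffices. *)
  + split=> //; apply: (lim (fun=> \1_(`[0, +oo[%classic)) _ 1).
    * exact: measurable_indic.
    * by move=> n; exact: Hray.
    * move=> _ z _; by rewrite indicE ger0_norm// lern1 leq_b1.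
    * move=> z z0; rewrite indicT indicE mem_set/=; first exact: cvg_cst.
      by rewrite in_itv/= z0.
  + move=> A B BA [mA HA] [mB HB]; split; first exact: measurableD.
    have -> : \1_(A `\` B) = fun z => -1 * \1_B z + \1_A z :> R.
      apply/funext => z; rewrite !indicE in_setD/=.
      have [/set_mem/BA/mem_set->|_] := boolP (z \in B) => /=; first by ring.
      by case: (z \in A) => /=; ring.
    exact: lin.
  + move=> F ndF FD; split; first by apply: bigcup_measurable => n _; case: (FD n).
    apply: (lim (fun n => \1_(F n)) _ 1).
    * by apply: measurable_indic; apply: bigcup_measurable => n _; case: (FD n).
    * by move=> n; case: (FD n).
    * move=> n z _; by rewrite indicE ger0_norm// lern1 leq_b1.
    * move=> z _; rewrite indicE.
      have [[n _ Fnz]|nF] := pselect ((\bigcup_n F n) z).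
        rewrite mem_set; last by exists n.
        apply: cvg_near_cst; exists n => // m /= nm.
        by rewrite indicE mem_set//; have /subsetPset := ndF _ _ nm; exact.
      rewrite memNset//; apply: cvg_near_cst; near=> n.
      by rewrite indicE memNset// => Fn; apply: nF; exists n.
- by move=> _ [x ->]; split; [exact: measurable_itv|exact: Hray].
Unshelve. all: by end_near. Qed.

(** On the half-line f is the uniform limit of floor((n+1) f)/(n+1), which is a combination of the
    indicators of n + 1 superlevel sets because f <= 1 there. *)
Lemma bp_closed_measurable01 :
  (forall B : set R, measurable B -> H (\1_B)) ->
  forall f : R -> R, measurable_fun setT f ->
  (forall z, 0 <= z -> 0 <= f z <= 1) -> H f.
Proof.
have [lin lim] := Hbp => Hindic f mf f01.
pose B (n k : nat) := [set z | k.+1%:R <= n.+1%:R * f z].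
have sumE N (x : R) : 0 <= x <= N%:R ->
    \sum_(0 <= k < N) (k.+1%:R <= x)%R%:R = (Num.truncn x)%:R :> R.
  move=> /andP[x0 xN].
  rewrite -natr_sum; congr _%:R.
  have tN : (Num.truncn x <= N)%N.
    by rewrite -(ler_nat R) (le_trans _ xN)// truncn_le.
  rewrite (big_cat_nat (n := Num.truncn x))//=.
  rewrite [X in (X + _)%N](_ : _ = Num.truncn x); last first.
    rewrite big_nat (eq_bigr (fun=> 1%N)).
      by rewrite -big_nat sum_nat_const_nat subn0 muln1.
    move=> i /andP[_ it]; have -> // : (i.+1%:R <= x)%R = true.
    by apply: (@le_trans _ _ (Num.truncn x)%:R); rewrite ?ler_nat ?truncn_le.
  rewrite big_nat big1 ?addn0// => i /andP[ti _].
  by rewrite leNgt (lt_le_trans (truncnS_gt x))// ler_nat.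
pose f_ (n : nat) (z : R) : R := \sum_(0 <= k < n.+1) n.+1%:R^-1 * \1_(B n k) z.
have fE n z : 0 <= z -> f_ n z = n.+1%:R^-1 * (Num.truncn (n.+1%:R * f z))%:R.
  move=> z0; have /andP[fz0 fz1] := f01 z z0.
  rewrite -(sumE n.+1); last by rewrite mulr_ge0//= ler_piMr.
  rewrite mulr_sumr; apply: eq_bigr => k _; congr (_ * _).
  rewrite indicE /B; congr (nat_of_bool _)%:R.
  by apply/idP/idP => [/set_mem|h]; last apply/mem_set.
have fb n z : 0 <= z -> f z - n.+1%:R^-1 <= f_ n z <= f z.
  move=> z0; have /andP[fz0 fz1] := f01 z z0; rewrite fE//.
  have t0 : 0 <= n.+1%:R * f z by rewrite mulr_ge0.
  have /andP[t1 t2] := truncn_itv t0.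
  rewrite ler_pdivrMl// t1 andbT ler_pdivlMl// mulrBr mulfV//.
  by rewrite lerBlDr natr1 ltW.
apply: (lim f_ f 1) => //.
- move=> n; apply: bp_closed_sum => // k; apply: Hindic.
  have m1 : measurable_fun setT (fun z => n.+1%:R * f z) by exact: measurable_funM.
  rewrite (_ : B n k = (fun z => n.+1%:R * f z) @^-1` `[k.+1%:R, +oo[).
    by rewrite -[X in measurable X]setTI; apply: m1.
  by apply/seteqP; split=> z /=; rewrite in_itv/= andbT.
- move=> n z z0; have /andP[_ h2] := fb n z z0; have /andP[_ h4] := f01 z z0.
  rewrite ger0_norm; first exact: le_trans h4.
  by rewrite fE// mulr_ge0.
- move=> z z0.
  apply: (@squeeze_cvgr _ _ _ _ (fun n => f z - n.+1%:R^-1) (cst (f z))).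
  + by near=> n; exact: fb.
  + rewrite -[X in _ --> X]subr0; apply: cvgB; first exact: cvg_cst.
    exact: cvg_harmonic.
  + exact: cvg_cst.
Unshelve. all: by end_near. Qed.

Lemma bp_closed_expm_indic c : 0 < c ->
  (forall y, 0 <= y <= c -> H (expm y)) ->
  forall B : set R, measurable B -> H (\1_B).
Proof.
move=> c0 Hc; apply: bp_closed_indic_measurable => x.
exact: (bp_closed_indic_ray Hbp (bp_closed_expm Hbp c0 Hc)).
Qed.

Lemma bp_closed_indic_expm :
  (forall B : set R, measurable B -> H (\1_B)) ->
  forall y, 0 <= y -> H (expm y).
Proof.
move=> Hindic y y0; apply: bp_closed_measurable01 => //.
  exact: measurable_expm.
by move=> z z0; rewrite expm_le1// expm_ge0.
Qed.

End indicators.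

(** * Laplace transforms, laws and independence *)

(* Expectation of a real random variable, junk unless it is integrable; locked
   because the unifier would otherwise unfold the integrals. *)
HB.lock Definition mean {d : measure_display} {T : measurableType d}
    {R : realType} (P : probability T R) (f : T -> R) : R := \int[P]_w f w.

Section bounded_expectation.
Context {d : measure_display} {T : measurableType d} {R : realType}.
Variable P : probability T R.
Implicit Types (f g : T -> R).

Definition bounded_mfun f : Prop :=
  measurable_fun setT f /\ exists M, forall w, `|f w| <= M.

Lemma bounded_mfun_integrable f : bounded_mfun f ->
  P.-integrable setT (EFin \o f).
Proof.
move=> [mf [M fM]]; apply: measurable_bounded_integrable => //.
  by apply: (le_lt_trans (probability_le1 P _)) => //; exact: ltry.
exists M; split; first exact: num_real.
by move=> x Mx w _ /=; exact: le_trans (fM w) (ltW Mx).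
Qed.

Lemma bounded_mfun_cst c : bounded_mfun (fun=> c).
Proof. by split; [exact: measurable_cst|exists `|c|]. Qed.

Lemma bounded_mfunD f g : bounded_mfun f -> bounded_mfun g ->
  bounded_mfun (fun w => f w + g w).
Proof.
move=> [mf [M fM]] [mg [N gN]]; split; first exact: measurable_funD.
by exists (M + N) => w; apply: le_trans (ler_normD _ _) _; exact: lerD.
Qed.

Lemma bounded_mfunM f g : bounded_mfun f -> bounded_mfun g ->
  bounded_mfun (fun w => f w * g w).
Proof.
move=> [mf [M fM]] [mg [N gN]]; split; first exact: measurable_funM.
by exists (M * N) => w; rewrite normrM; exact: ler_pM.
Qed.

Lemma bounded_mfun_prod (I : Type) (s : seq I) (p : pred I) (h : I -> T -> R) :
  (forall i, p i -> bounded_mfun (h i)) ->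
  bounded_mfun (fun w => \prod_(i <- s | p i) h i w).
Proof.
move=> bh; elim: s => [|i s IH].
  by under eq_fun do rewrite big_nil; exact: bounded_mfun_cst.
under eq_fun do rewrite big_cons.
by have [/bh bi|_] := boolP (p i); [exact: bounded_mfunM|exact: IH].
Qed.

Lemma bounded_mfun_indic (A : set T) : measurable A -> bounded_mfun (\1_A).
Proof.
move=> mA; split; first exact: measurable_indic.
by exists 1 => w; rewrite indicE ger0_norm// lern1 leq_b1.
Qed.

Local Notation mean := (mean P).

Lemma meanE f : mean f = \int[P]_w f w.
Proof. by rewrite mean.unlock. Qed.

Lemma mean_cst c : mean (fun=> c) = c.
Proof.
rewrite meanE Rintegral_cst//.
by have /= -> := congr1 fine (probability_setT P); rewrite mulr1.
Qed.

Lemma meanD f g : bounded_mfun f -> bounded_mfun g ->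
  mean (fun w => f w + g w) = mean f + mean g.
Proof.
by move=> bf bg; rewrite !meanE RintegralD//; exact: bounded_mfun_integrable.
Qed.

Lemma meanZ c f : bounded_mfun f -> mean (fun w => c * f w) = c * mean f.
Proof.
by move=> bf; rewrite !meanE RintegralZl//; exact: bounded_mfun_integrable.
Qed.

Lemma mean_sum (I : Type) (s : seq I) (h : I -> T -> R) :
  (forall i, bounded_mfun (h i)) ->
  mean (fun w => \sum_(i <- s) h i w) = \sum_(i <- s) mean (h i).
Proof.
move=> bh.
suff [] : bounded_mfun (fun w => \sum_(i <- s) h i w) /\
    mean (fun w => \sum_(i <- s) h i w) = \sum_(i <- s) mean (h i) by [].
elim: s => [|i s [IH1 IH2]].
  under eq_fun do rewrite big_nil; rewrite big_nil mean_cst.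
  by split=> //; exact: bounded_mfun_cst.
under eq_fun do rewrite big_cons; rewrite big_cons -IH2 meanD//.
by split=> //; exact: bounded_mfunD.
Qed.

Lemma mean_indic (A : set T) : measurable A -> mean (\1_A) = fine (P A).
Proof. by move=> mA; rewrite meanE /Rintegral integral_indic// setIT. Qed.

Lemma le_mean f g : bounded_mfun f -> bounded_mfun g ->
  (forall w, f w <= g w) -> mean f <= mean g.
Proof.
move=> bf bg fg; rewrite !meanE.
by apply: le_Rintegral => //; exact: bounded_mfun_integrable.
Qed.

Lemma mean_ae f g : measurable_fun setT f -> measurable_fun setT g ->
  {ae P, forall w, f w = g w} -> mean f = mean g.
Proof.
move=> mf mg fg; rewrite !meanE; congr fine; apply: ae_eq_integral => //.
- exact/measurable_EFinP.
- exact/measurable_EFinP.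
- by apply: filterS fg => w fgw _; rewrite /= fgw.
Qed.

(** Dominated convergence, a constant being integrable for a probability. Measurability of the limit
    is delivered as well, so it need not be known beforehand. *)
Lemma bounded_cvg_mean (f_ : nat -> T -> R) f M :
  (forall n, measurable_fun setT (f_ n)) -> (forall n w, `|f_ n w| <= M) ->
  (forall w, f_ n w @[n --> \oo] --> f w) ->
  bounded_mfun f /\ mean (f_ n) @[n --> \oo] --> mean f.
Proof.
move=> mf_ fM f_f.
have mf : measurable_fun setT f.
  by apply: (measurable_fun_cvg mf_) => w _; exact: f_f.
have bf : bounded_mfun f.
  split=> //; exists M => w.
  have cf : `|f_ n w| @[n --> \oo] --> `|f w| by apply: cvg_norm; exact: f_f.
  move/cvg_lim : (cf) => <- //.
  by apply: limr_le; [apply: cvgP; exact: cf|exact: nearW].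
split=> //; rewrite meanE; under eq_fun do rewrite meanE; apply: fine_cvg.
rewrite fineK; last first.
  by apply: integrable_fin_num => //; exact: bounded_mfun_integrable.
apply: (@dominated_cvg _ _ _ _ _ _ _ _ (cst M%:E)) => //.
- by move=> n; exact/measurable_EFinP.
- by move=> w _; apply: cvg_EFin; [exact: nearW|exact: f_f].
- exact: (bounded_mfun_integrable (bounded_mfun_cst M)).
- by move=> n w _; rewrite lee_fin; exact: fM.
Qed.

End bounded_expectation.

Section bp_mean.
Context {d : measure_display} {T : measurableType d} {R : realType}.
Variable P : probability T R.

(** The bound concerns the half-line only, since [expm y] with y > 0 is unbounded at -oo; such g are
    composed with nonnegative variables. *)
Definition bounded_mfun_nneg (g : R -> R) : Prop :=
  measurable_fun setT g /\ exists M, forall z, 0 <= z -> `|g z| <= M.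

Lemma bounded_mfun_comp (Z : T -> R) (g : R -> R) : measurable_fun setT Z ->
  (forall w, 0 <= Z w) -> bounded_mfun_nneg g -> bounded_mfun (fun w => g (Z w)).
Proof.
move=> mZ Z0 [mg [M gM]]; split; first exact: measurableT_comp.
by exists M => w; exact: gM.
Qed.

Lemma bounded_mfun_nneg_expm (y : R) : 0 <= y -> bounded_mfun_nneg (expm y).
Proof.
move=> y0; split; first exact: measurable_expm.
by exists 1 => z z0; rewrite ger0_norm ?expm_le1// expm_ge0.
Qed.

Lemma bounded_mfun_nneg_indic (B : set R) : measurable B ->
  bounded_mfun_nneg (\1_B).
Proof.
move=> mB; split; first exact: measurable_indic.
by exists 1 => z _; rewrite indicE ger0_norm// lern1 leq_b1.
Qed.

(** Linearity and bounded convergence of [mean]. Boundedness belongs to the set because linearity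
    needs integrable functions. *)
Lemma bp_closed_mean_eq (Z Z' W W' : T -> R) :
  measurable_fun setT Z -> measurable_fun setT Z' ->
  (forall w, 0 <= Z w) -> (forall w, 0 <= Z' w) ->
  bounded_mfun W -> bounded_mfun W' ->
  bp_closed [set g : R -> R | bounded_mfun_nneg g /\
    mean P (fun w => g (Z w) * W w) = mean P (fun w => g (Z' w) * W' w)].
Proof.
move=> mZ mZ' Z0 Z'0 bW bW'; split.
- move=> a f g [bf fE] [bg gE]; split.
    move: bf bg => [mf [M fM]] [mg [N gN]]; split.
      by apply: measurable_funD => //; exact: measurable_funM.
    exists (`|a| * M + N) => z z0; apply: le_trans (ler_normD _ _) _.
    by rewrite lerD ?gN// normrM ler_wpM2l ?fM.
  have E (Y V : T -> R) : measurable_fun setT Y -> (forall w, 0 <= Y w) ->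
      bounded_mfun V ->
      mean P (fun w => (a * f (Y w) + g (Y w)) * V w) =
      a * mean P (fun w => f (Y w) * V w) + mean P (fun w => g (Y w) * V w).
    move=> mY Y0 bV.
    have b1 h : bounded_mfun_nneg h -> bounded_mfun (fun w => h (Y w) * V w).
      by move=> bh; apply: bounded_mfunM => //; exact: bounded_mfun_comp.
    rewrite -meanZ; last exact: b1.
    rewrite -meanD; last 2 first.
    - by apply: bounded_mfunM; [exact: bounded_mfun_cst|exact: b1].
    - exact: b1.
    by congr mean; apply/funext => w; ring.
  by rewrite !E// fE gE.
- move=> f_ f M mf Hf_ fM f_f; split.
    split=> //; exists M => z z0.
    have cf : `|f_ n z| @[n --> \oo] --> `|f z| by apply: cvg_norm; exact: f_f.
    move/cvg_lim : (cf) => <- //.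
    by apply: limr_le; [apply: cvgP; exact: cf|apply: nearW => n; exact: fM].
  have C (Y V : T -> R) : measurable_fun setT Y -> (forall w, 0 <= Y w) ->
      bounded_mfun V -> mean P (fun w => f_ n (Y w) * V w) @[n --> \oo] -->
      mean P (fun w => f (Y w) * V w).
    move=> mY Y0 bV; have [mV [N VN]] := bV.
    have [] // := @bounded_cvg_mean _ _ _ P (fun n w => f_ n (Y w) * V w)
      (fun w => f (Y w) * V w) (M * N).
    + move=> n; apply: measurable_funM => //.
      by have [[mfn _] _] := Hf_ n; exact: measurableT_comp.
    + by move=> n w; rewrite normrM ler_pM// fM.
    + by move=> w; apply: cvgMr_tmp; exact: f_f.
  have c1 := C _ _ mZ Z0 bW; have c2 := C _ _ mZ' Z'0 bW'.
  apply: (cvg_unique _ c1) => //.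
  rewrite (_ : (fun n => _) = fun n => mean P (fun w => f_ n (Z' w) * W' w))//.
  by apply/funext => n; have [_ ->] := Hf_ n.
Qed.

(** Quantifying over every [bp_closed] H makes both passages, from exponentials to indicators and
    back, instances of one statement. Weights equal to 1 compare laws; a random weight against a
    constant one expresses independence. *)
Lemma bp_transfer_mean (A B : set (R -> R)) (Z Z' W W' : T -> R) :
  (forall H, bp_closed H -> A `<=` H -> B `<=` H) ->
  A `<=` bounded_mfun_nneg ->
  measurable_fun setT Z -> measurable_fun setT Z' ->
  (forall w, 0 <= Z w) -> (forall w, 0 <= Z' w) ->
  bounded_mfun W -> bounded_mfun W' ->
  (forall g, A g ->
    mean P (fun w => g (Z w) * W w) = mean P (fun w => g (Z' w) * W' w)) ->
  forall g, B g ->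
    mean P (fun w => g (Z w) * W w) = mean P (fun w => g (Z' w) * W' w).
Proof.
move=> AB bA mZ mZ' Z0 Z'0 bW bW' HA g Bg.
suff AH : A `<=` [set g | bounded_mfun_nneg g /\
    mean P (fun w => g (Z w) * W w) = mean P (fun w => g (Z' w) * W' w)].
  by have [] := AB _ (bp_closed_mean_eq mZ mZ' Z0 Z'0 bW bW') AH g Bg.
by move=> h Ah; split; [exact: bA|exact: HA].
Qed.

Definition mean_factorizes (I : finType) (Z : I -> T -> R) (f : I -> R -> R) :=
  mean P (fun w => \prod_i f i (Z i w)) = \prod_i mean P (fun w => f i (Z i w)).

(** Test functions are exchanged one index at a time, s listing the indices already allowed in B.
    For the next index i, the product of the other factors is the weight on one side and the product
    of their means the constant weight on the other, which turns factorization into an equality of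
    weighted means. *)
Lemma bp_transfer_factorization (A B : set (R -> R)) (I : finType)
    (Z : I -> T -> R) :
  (forall H, bp_closed H -> A `<=` H -> B `<=` H) ->
  A `<=` bounded_mfun_nneg -> B `<=` bounded_mfun_nneg ->
  (forall i, measurable_fun setT (Z i)) -> (forall i w, 0 <= Z i w) ->
  (forall f, (forall i, A (f i)) -> mean_factorizes Z f) ->
  forall f, (forall i, B (f i)) -> mean_factorizes Z f.
Proof.
move=> AB bA bB mZ Z0 FA.
suff FAB (s : seq I) : forall f, (forall i, i \in s -> B (f i)) ->
    (forall i, i \notin s -> A (f i)) -> mean_factorizes Z f.
  move=> f Bf; apply: (FAB (enum I)) => [i _|i]; first exact: Bf.
  by rewrite mem_enum.
elim: s => [|i s IH] f Bf Af; first by apply: FA => i; exact: Af.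
have [si|si] := boolP (i \in s).
  apply: IH => j js; first by apply: Bf; rewrite inE js orbT.
  by apply: Af; rewrite inE negb_or js andbT; apply: contraNneq js => ->.
have Bfi : B (f i) by apply: Bf; rewrite inE eqxx.
have bf j : bounded_mfun_nneg (f j).
  have [js|js] := boolP (j \in i :: s).
    by apply: bB; exact: Bf.
  by apply: bA; exact: Af.
have bfZ j : bounded_mfun (fun w => f j (Z j w)) by exact: bounded_mfun_comp.
pose W w := \prod_(j | j != i) f j (Z j w).
pose C := \prod_(j | j != i) mean P (fun w => f j (Z j w)).
suff E : mean P (fun w => f i (Z i w) * W w) = mean P (fun w => f i (Z i w) * C).
  rewrite /mean_factorizes [RHS](bigD1 i)//= -/C mulrC -meanZ//.
  under [in RHS]eq_fun do rewrite mulrC.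
  by rewrite -E; congr mean; apply/funext => w; rewrite (bigD1 i).
apply: (bp_transfer_mean AB bA) => //.
- exact: bounded_mfun_prod.
- exact: bounded_mfun_cst.
move=> g Ag.
(* With g from A at index i the induction hypothesis applies, since i is not in s. *)
pose f' j := if j == i then g else f j.
have : mean_factorizes Z f'.
  apply: IH => j js; rewrite /f'; case: eqP js => [-> |ji] js.
  - by rewrite js in si.
  - by apply: Bf; rewrite inE js orbT.
  - exact: Ag.
  - by apply: Af; rewrite inE negb_or js andbT; exact/eqP.
rewrite /mean_factorizes (bigD1 i)//= {2}/f' eqxx.
rewrite (eq_bigr (fun j => mean P (fun w => f j (Z j w)))); last first.
  by move=> j /negbTE ji; rewrite /f' ji.
rewrite -/C mulrC -meanZ; last by apply: bounded_mfun_comp => //; exact: bA.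
under [in RHS]eq_fun do rewrite mulrC.
move=> <-; congr mean; apply/funext => w; rewrite (bigD1 i)//= {1}/f' eqxx.
by congr (_ * _); apply: eq_bigr => j /negbTE ji; rewrite /f' ji.
Qed.

(** A product of indicators is the indicator of an intersection; the rest converts between real and
    extended values of P. *)
Lemma mutually_independentE (I : finType) (Z : I -> T -> R) :
  (forall i, measurable_fun setT (Z i)) ->
  mutually_independent P Z <->
  forall f, (forall i, [set \1_B | B in measurable] (f i)) -> mean_factorizes Z f.
Proof.
move=> mZ.
have mpre i (B : set R) : measurable B -> measurable (Z i @^-1` B).
  by move=> mB; rewrite -[X in measurable X]setTI; exact: mZ.
have E (B : I -> set R) : (forall i, measurable (B i)) ->
    (mean_factorizes Z (fun i => \1_(B i)) <->
    P (\bigcap_(i in [set: I]) (Z i @^-1` B i)) =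
      (\prod_(i in I) P (Z i @^-1` B i))%E).
  move=> mB.
  have mcap : measurable (\bigcap_(i in [set: I]) (Z i @^-1` B i)).
    by apply: fin_bigcap_measurable => // i _; exact: mpre.
  rewrite /mean_factorizes.
  rewrite (_ : (fun w => \prod_i _) =
      \1_(\bigcap_(i in [set: I]) (Z i @^-1` B i))); last first.
    apply/funext => w; rewrite [RHS]indicE.
    have [/set_mem wB|/negP wB] := boolP (w \in _).
      by rewrite big1// => i _; rewrite indicE mem_set//; exact: wB.
    have [i nBi] : exists i, ~ B i (Z i w).
      apply/existsNP => h; apply: wB; apply/mem_set => i _; exact: h.
    by rewrite (bigD1 i)//= indicE memNset// mul0r.
  rewrite mean_indic//.
  rewrite (eq_bigr (fun i => fine (P (Z i @^-1` B i)))); last first.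
    by move=> i _; rewrite -mean_indic//; exact: mpre.
  rewrite (eq_bigr (fun i => (fine (P (Z i @^-1` B i)))%:E)); last first.
    by move=> i _; rewrite fineK// fin_num_measure//; exact: mpre.
  rewrite prodEFin; rewrite -[X in _ <-> X = _]fineK ?fin_num_measure//.
  by split=> [->//|[]].
split=> [ind f fB|fact B mB].
  have /choice[B BE] i : exists B, measurable B /\ \1_B = f i.
    by have [B ? ?] := fB i; exists B.
  have -> : f = fun i => \1_(B i) by apply/funext => i; have [_ <-] := BE i.
  by apply/E => [i|]; [have [] := BE i|apply: ind => i; have [] := BE i].
by apply/E => //; apply: fact => i; exists (B i).
Qed.

Lemma mutually_independent_expm (I : finType) (Z : I -> T -> R) :
  (forall i, measurable_fun setT (Z i)) -> (forall i w, 0 <= Z i w) ->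
  mutually_independent P Z ->
  forall y : I -> R, (forall i, 0 <= y i) ->
    mean_factorizes Z (fun i => expm (y i)).
Proof.
move=> mZ Z0 /(mutually_independentE mZ) ind y y0.
apply: (bp_transfer_factorization (A := [set \1_B | B in measurable])
  (B := [set expm y | y in [set y | 0 <= y]])) => //.
- move=> H Hbp HA _ [x x0 <-]; apply: bp_closed_indic_expm => // B mB.
  by apply: HA; exists B.
- by move=> _ [B mB <-]; exact: bounded_mfun_nneg_indic.
- by move=> _ [x x0 <-]; exact: bounded_mfun_nneg_expm.
- by move=> i; exists (y i) => //; exact: y0.
Qed.

Lemma expm_mutually_independent (I : finType) (Z : I -> T -> R) (c : R) :
  0 < c ->
  (forall i, measurable_fun setT (Z i)) -> (forall i w, 0 <= Z i w) ->
  (forall y : I -> R, (forall i, 0 <= y i <= c) ->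
    mean_factorizes Z (fun i => expm (y i))) ->
  mutually_independent P Z.
Proof.
move=> c0 mZ Z0 lap; apply/(mutually_independentE mZ).
apply: (bp_transfer_factorization (B := [set \1_B | B in measurable])
    (A := [set expm y | y in [set y | 0 <= y <= c]])) => //.
- move=> H Hbp HA _ [B mB <-]; apply: (bp_closed_expm_indic Hbp c0) => // y yc.
  by apply: HA; exists y.
- by move=> _ [y /andP[y0 _] <-]; exact: bounded_mfun_nneg_expm.
- by move=> _ [B mB <-]; exact: bounded_mfun_nneg_indic.
- move=> f fE; have /choice[y yE] i : exists y, 0 <= y <= c /\ expm y = f i.
    by have [y ? ?] := fE i; exists y.
  have -> : f = fun i => expm (y i) by apply/funext => i; have [_ <-] := yE i.
  by apply: lap => i; have [] := yE i.
Qed.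

Lemma mean_expm_eq_law (Z Z' : T -> R) :
  measurable_fun setT Z -> measurable_fun setT Z' ->
  (forall w, 0 <= Z w) -> (forall w, 0 <= Z' w) ->
  (forall B, measurable B -> P (Z @^-1` B) = P (Z' @^-1` B)) ->
  forall y, 0 <= y ->
    mean P (fun w => expm y (Z w)) = mean P (fun w => expm y (Z' w)).
Proof.
move=> mZ mZ' Z0 Z'0 law y y0.
have mu1 (f : T -> R) : (fun w => f w * 1) = f.
  by apply/funext => w; rewrite mulr1.
have mpre (Y : T -> R) (B : set R) : measurable_fun setT Y -> measurable B ->
    measurable (Y @^-1` B).
  by move=> mY mB; rewrite -[X in measurable X]setTI; exact: mY.
have := bp_transfer_mean (A := [set \1_B | B in measurable])
  (B := [set expm y | y in [set y | 0 <= y]]) _ _ mZ mZ' Z0 Z'0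
  (bounded_mfun_cst 1) (bounded_mfun_cst 1) _ (g := expm y).
rewrite !mu1; apply.
- move=> H Hbp HA _ [x x0 <-]; apply: bp_closed_indic_expm => // B mB.
  by apply: HA; exists B.
- by move=> _ [B mB <-]; exact: bounded_mfun_nneg_indic.
- move=> _ [B mB <-]; rewrite !mu1.
  have := congr1 fine (law B mB).
  by rewrite -!mean_indic//; exact: mpre.
- by exists y.
Qed.

Lemma eq_law_mean_expm (Z Z' : T -> R) (c : R) : 0 < c ->
  measurable_fun setT Z -> measurable_fun setT Z' ->
  (forall w, 0 <= Z w) -> (forall w, 0 <= Z' w) ->
  (forall y, 0 <= y <= c ->
     mean P (fun w => expm y (Z w)) = mean P (fun w => expm y (Z' w))) ->
  forall B, measurable B -> P (Z @^-1` B) = P (Z' @^-1` B).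
Proof.
move=> c0 mZ mZ' Z0 Z'0 lap B mB.
have mu1 (f : T -> R) : (fun w => f w * 1) = f.
  by apply/funext => w; rewrite mulr1.
have mpre (Y : T -> R) : measurable_fun setT Y -> measurable (Y @^-1` B).
  by move=> mY; rewrite -[X in measurable X]setTI; exact: mY.
have := bp_transfer_mean (B := [set \1_B | B in measurable])
    (A := [set expm y | y in [set y | 0 <= y <= c]]) _ _ mZ mZ' Z0 Z'0
    (bounded_mfun_cst 1) (bounded_mfun_cst 1) _ (g := \1_B).
rewrite !mu1 => h.
have : mean P (\1_(Z @^-1` B)) = mean P (\1_(Z' @^-1` B)).
  apply: h.
  - move=> H Hbp HA _ [D mD <-]; apply: (bp_closed_expm_indic Hbp c0) => // y yc.
    by apply: HA; exists y.
  - by move=> _ [y /andP[y0 _] <-]; exact: bounded_mfun_nneg_expm.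
  - by move=> _ [y yc <-]; rewrite !mu1; exact: lap.
  - by exists B.
rewrite !mean_indic; [|exact: mpre..].
move=> PE; rewrite -[LHS]fineK ?fin_num_measure//; last exact: mpre.
by rewrite PE fineK// fin_num_measure//; exact: mpre.
Qed.

End bp_mean.

(** * The Laplace exponent *)

Lemma nneg_times (R : realType) n (t : nat -> R) : 0 <= t 0%N ->
  (forall i, (i < n)%N -> t i <= t i.+1) -> forall i, (i <= n)%N -> 0 <= t i.
Proof.
move=> t0 tle; elim=> // i IH ni.
by apply: le_trans (IH (ltnW ni)) _; exact: tle.
Qed.

Section subordinator_laplace.
Context {d : measure_display} {T : measurableType d} {R : realType}.
Variables (P : probability T R) (L : R -> T -> R) (phi : R -> R).
Hypothesis mL : forall t, 0 <= t -> measurable_fun setT (L t).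
Hypothesis L_subordinator : subordinator P L.
Hypothesis L_laplace : forall x, 0 <= x ->
  mean P (fun w => expm x (L 1 w)) = expR (- phi x).

Let L_nd : nondecreasing_paths L. Proof. by case: L_subordinator. Qed.

Let mdL s t : 0 <= s -> s <= t -> measurable_fun setT (fun w => L t w - L s w).
Proof.
by move=> s0 st; apply: measurable_funB; apply: mL => //; exact: le_trans st.
Qed.

Let dL0 s t w : 0 <= s -> s <= t -> 0 <= L t w - L s w.
Proof. by move=> s0 st; rewrite subr_ge0; exact: L_nd. Qed.

(** [L 0] is subtracted because it vanishes only almost surely, whereas increments are nonnegative
    for every w. *)
Let g x t := mean P (fun w => expm x (L t w - L 0 w)).

Let bdL x s t : 0 <= x -> 0 <= s -> s <= t ->
  bounded_mfun (fun w => expm x (L t w - L s w)).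
Proof.
move=> x0 s0 st; apply: (bounded_mfun_comp (Z := fun w => L t w - L s w)).
- exact: mdL.
- by move=> w; exact: dL0.
- exact: bounded_mfun_nneg_expm.
Qed.

Lemma mean_expm_increment x s t : 0 <= x -> 0 <= s -> s <= t ->
  mean P (fun w => expm x (L t w - L s w)) = g x (t - s).
Proof.
move=> x0 s0 st; have ts0 : 0 <= t - s by rewrite subr_ge0.
apply: mean_expm_eq_law => //; [exact: mdL|exact: mdL|..].
- by move=> w; exact: dL0.
- by move=> w; exact: dL0.
move=> B mB; have [_ _ _ _ [stat _]] := L_subordinator.
by have := stat s (t - s) B s0 ts0 mB; rewrite subrKC.
Qed.

Let gD x s t : 0 <= x -> 0 < s -> 0 < t -> g x (s + t) = g x s * g x t.
Proof.
move=> x0 s0 t0; have [_ _ _ _ [_ ind]] := L_subordinator.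
(* The times 0, s, s + t; the constant value beyond index 2 is a filler. *)
pose u (i : nat) := if i is j.+1 then (if j is _.+1 then s + t else s) else 0.
have u_lt i : (i < 2)%N -> u i < u i.+1.
  by case: i => [|[|]]//= _; rewrite ltrDl.
have u_ge0 i : 0 <= u i.
  by case: i => [|[|i]]//=; rewrite ?ltW// addr_gt0.
have mu (i : 'I_2) : measurable_fun setT (fun w => L (u i.+1) w - L (u i) w).
  by apply: mdL => //; apply: ltW; exact: u_lt.
have Z0 (i : 'I_2) w : 0 <= L (u i.+1) w - L (u i) w.
  by apply: dL0 => //; apply: ltW; exact: u_lt.
have := mutually_independent_expm mu Z0 (ind 2%N u (u_ge0 0%N) u_lt)
  (y := fun=> x) (fun=> x0).
rewrite /mean_factorizes !big_ord_recl big_ord0 mulr1/=.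
rewrite (@mean_expm_increment x s (s + t))//; [|exact: ltW|by rewrite lerDl ltW].
rewrite addrAC subrr add0r => <-.
congr mean; apply/funext => w; rewrite !big_ord_recl big_ord0 mulr1/=.
by rewrite /expm -expRD; congr expR; ring.
Qed.

Let gMn x t n : 0 <= x -> 0 < t -> g x (n.+1%:R * t) = g x t ^+ n.+1.
Proof.
move=> x0 t0; elim: n => [|n IH]; first by rewrite mul1r expr1.
rewrite exprSr -IH -gD//; last by rewrite mulr_gt0.
by rewrite -natr1 mulrDl mul1r.
Qed.

Let g1 x : 0 <= x -> g x 1 = expR (- phi x).
Proof.
move=> x0; rewrite -L_laplace//; apply: mean_ae.
- exact: (bdL x0 (lexx _) ler01).1.
- by apply: measurableT_comp; [exact: measurable_expm|exact: mL].
have [_ _ _ L0 _] := L_subordinator.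
by apply: filterS L0 => w ->; rewrite subr0.
Qed.

Let g_le x s t : 0 <= x -> 0 <= s -> s <= t -> g x t <= g x s.
Proof.
move=> x0 s0 st; apply: le_mean.
- by apply: bdL => //; exact: le_trans st.
- exact: bdL.
- move=> w; rewrite ler_expR lerN2 ler_wpM2l// lerD2r.
  exact: L_nd.
Qed.

Let g_le1 x t : 0 <= x -> 0 <= t -> g x t <= 1.
Proof.
move=> x0 t0; rewrite -[leRHS](mean_cst P 1); apply: le_mean.
- exact: bdL.
- exact: bounded_mfun_cst.
- by move=> w; rewrite expm_le1// dL0.
Qed.

Lemma laplace_exponent_ge0 x : 0 <= x -> 0 <= phi x.
Proof. by move=> x0; rewrite -oppr_le0 -ler_expR expR0 -g1// g_le1. Qed.

Let g_nat x n : 0 <= x -> g x n.+1%:R = expR (- (phi x * n.+1%:R)).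
Proof.
move=> x0; rewrite -[n.+1%:R]mulr1 gMn// g1// -expRM_natl mulr1.
by congr expR; ring.
Qed.

(* [g t ^ m = g (m t)] lies between the values of [g] at the integers next to
   [m t]; let [m] tend to infinity. *)
Let gE x t : 0 <= x -> 0 < t -> g x t = expm (phi x) t.
Proof.
move=> x0 t0; have p0 := laplace_exponent_ge0 x0.
have gub s : 0 <= s -> expR (- (phi x * (Num.truncn s).+1%:R)) <= g x s.
  move=> s0; rewrite -g_nat//; apply: g_le => //.
  by apply: ltW; exact: truncnS_gt.
have glb s : 0 <= s -> g x s <= expR (- (phi x * (Num.truncn s)%:R)).
  move=> s0; have := truncn_le s; rewrite s0.
  case: (Num.truncn s) => [|k] ks; first by rewrite mulr0 oppr0 expR0 g_le1.
  by rewrite -g_nat// g_le.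
have gt0 : 0 < g x t by apply: lt_le_trans (gub t (ltW t0)); exact: expR_gt0.
pose G := - ln (g x t).
have gG : g x t = expR (- G) by rewrite /G opprK lnK.
(* All positive integer multiples of the difference stay within [phi x], which forces the difference
   to be 0. *)
have bnd m : `|m.+1%:R * (G - phi x * t)| <= phi x.
  have mt0 : 0 <= m.+1%:R * t by rewrite mulr_ge0// ltW.
  have := glb _ mt0; have := gub _ mt0; have := truncn_itv mt0.
  rewrite gMn// gG -expRM_natl !ler_expR.
  set k := Num.truncn _; rewrite -[k.+1%:R]natr1 => /andP[h1 h2] h3 h4.
  by rewrite ler_norml; apply/andP; split; nra.
rewrite gG /expm; congr expR; congr (- _).
apply/eqP; rewrite -subr_eq0; apply/negP => /negP D0.
pose D := `|G - phi x * t|; have Dp : 0 < D by rewrite normr_gt0.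
have := bnd (Num.truncn (phi x / D)); rewrite normrM normr_nat -/D.
have := truncnS_gt (phi x / D); rewrite ltr_pdivrMr// => h1 h2.
by have := lt_le_trans h1 h2; rewrite ltxx.
Qed.

Lemma mean_expm_increments n (t : nat -> R) (x : 'I_n -> R) :
  0 <= t 0%N -> (forall i, (i < n)%N -> t i < t i.+1) -> (forall i, 0 <= x i) ->
  mean P (fun w => \prod_i expm (x i) (L (t i.+1) w - L (t i) w)) =
  \prod_i expm (phi (x i)) (t i.+1 - t i).
Proof.
move=> t00 tlt x0; have [_ _ _ _ [_ ind]] := L_subordinator.
have t_ge0 := nneg_times t00 (fun i ni => ltW (tlt i ni)).
have mZ (i : 'I_n) : measurable_fun setT (fun w => L (t i.+1) w - L (t i) w).
  by apply: mdL; [apply: t_ge0; exact: ltnW|apply: ltW; exact: tlt].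
have Z0 (i : 'I_n) w : 0 <= L (t i.+1) w - L (t i) w.
  by apply: dL0; [apply: t_ge0; exact: ltnW|apply: ltW; exact: tlt].
have := mutually_independent_expm mZ Z0 (ind n t t00 tlt) x0.
rewrite /mean_factorizes => ->; apply: eq_bigr => i _.
rewrite mean_expm_increment//; last 2 first.
- by apply: t_ge0; exact: ltnW.
- by apply: ltW; exact: tlt.
by rewrite gE// subr_gt0; exact: tlt.
Qed.

(** Intermediate values of the transform at time 1, which is continuous in x by bounded convergence
    and goes from 1 to e^{-phi x0}; injectivity of exp then gives the value of phi. *)
Lemma laplace_exponent_surj x0 y : 0 <= x0 -> 0 <= y <= phi x0 ->
  exists2 x, 0 <= x & phi x = y.
Proof.
move=> x00 /andP[y0 yx0].
(* The absolute value extends the transform to a bounded continuous function on the whole line. *)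
pose F (x : R) : R := g `|x| 1.
have cF : continuous F.
  move=> a; apply/(@cvg_nbhsP _ R^o) => u ua.
  have [] // := @bounded_cvg_mean _ _ _ P
    (fun n w => expm `|u n : R| (L 1 w - L 0 w))
    (fun w => expm `|a : R| (L 1 w - L 0 w)) 1.
  - by move=> n; exact: (bdL (normr_ge0 _) (lexx _) ler01).1.
  - by move=> n w; rewrite ger0_norm ?expm_ge0// expm_le1// dL0.
  - move=> w; apply: cvg_expR; apply: cvgN; apply: cvgMr_tmp.
    by apply: cvg_norm; exact: ua.
have F0 : F 0 = 1.
  rewrite /F normr0 -[RHS](mean_cst P 1); congr mean; apply/funext => w.
  by rewrite /expm mul0r oppr0 expR0.
have Fx x : 0 <= x -> F x = expR (- phi x) by move=> x1; rewrite /F ger0_norm// g1.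
have Fle : F x0 <= F 0 by rewrite F0 Fx// -expR0 ler_expR oppr_le0 (le_trans y0).
have [|x xi xE] := @IVT R F 0 x0 (expR (- y)) x00 (continuous_subspaceT cF).
  rewrite (min_idPr Fle) (max_idPl Fle) Fx// F0 ler_expR lerN2 yx0/=.
  by rewrite -expR0 ler_expR oppr_le0.
have xge0 : 0 <= x by move: xi; rewrite in_itv/= => /andP[].
exists x => //; move: xE; rewrite Fx// => /expR_inj/eqP.
by rewrite eqr_opp => /eqP.
Qed.

End subordinator_laplace.

(** * Discretization of the time change *)

Section sigma_process.
Context {d : measure_display} {T : measurableType d} {R : realType}.
Variable P : probability T R.

Let events (X : R -> T -> R) : set (set T) :=
  [set A | exists t (B : set R), [/\ 0 <= t, measurable B & A = X t @^-1` B]].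

(** T is viewed with the sigma-algebra generated by X, so that measurability of sums and products of
    the [X t] yields events of [sigma_process X]. *)
Lemma sigma_process_comp (X : R -> T -> R) (f : T -> R) :
  measurable_fun setT (f : g_sigma_algebraType (events X) -> R) ->
  forall B, measurable B -> sigma_process X (f @^-1` B).
Proof. by move=> mf B mB; have := mf measurableT B mB; rewrite setTI. Qed.

Lemma measurable_sigma_process (X : R -> T -> R) (t : R) : 0 <= t ->
  measurable_fun setT (X t : g_sigma_algebraType (events X) -> R).
Proof.
by move=> t0 _ B mB; rewrite setTI; apply: sub_sigma_algebra; exists t, B.
Qed.

Lemma sigma_process_bigcap (X : R -> T -> R) (I : finType) (F : I -> set T) :
  (forall i, sigma_process X (F i)) -> sigma_process X (\bigcap_i F i).
Proof.
move=> XF; rewrite /sigma_process.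
by apply: (@fin_bigcap_measurable _ (g_sigma_algebraType _)) => // i _; exact: XF.
Qed.

Lemma sub_sigma_process (X : R -> T -> R) :
  (forall t, 0 <= t -> measurable_fun setT (X t)) ->
  sigma_process X `<=` measurable.
Proof.
move=> mX; apply: smallest_sub; first exact: sigma_algebra_measurable.
by move=> _ [t [B [t0 mB ->]]]; rewrite -[X in measurable X]setTI; exact: mX.
Qed.

(** With an indicator in place of [expm 1] this is the product rule for events; the weights 1_A and
    P(A) carry it over to exponentials. *)
Lemma mean_expm_indic (X Y : R -> T -> R) (G : T -> R) (A : set T) :
  (forall t, 0 <= t -> measurable_fun setT (X t)) ->
  (forall t, 0 <= t -> measurable_fun setT (Y t)) ->
  independent_processes P X Y ->
  (forall B, measurable B -> sigma_process X (G @^-1` B)) ->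
  (forall w, 0 <= G w) -> sigma_process Y A ->
  mean P (fun w => expm 1 (G w) * \1_A w) =
  mean P (fun w => expm 1 (G w) * fine (P A)).
Proof.
move=> mX mY indep XG G0 YA.
have mA : measurable A by exact: (sub_sigma_process mY).
have mG' B : measurable B -> measurable (G @^-1` B).
  by move=> mB; apply: (sub_sigma_process mX); exact: XG.
have mG : measurable_fun setT G by move=> _ B mB; rewrite setTI; exact: mG'.
apply: (bp_transfer_mean (A := [set \1_B | B in measurable])
  (B := [set expm y | y in [set y | 0 <= y]]) _ _ mG mG G0 G0
  (bounded_mfun_indic mA) (bounded_mfun_cst _)).
- move=> H Hbp HA _ [x x0 <-]; apply: bp_closed_indic_expm => // B mB.
  by apply: HA; exists B.
- by move=> _ [B mB <-]; exact: bounded_mfun_nneg_indic.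
- move=> _ [B mB <-].
  rewrite (_ : (fun w => _) = \1_(G @^-1` B `&` A)); last first.
    by apply/funext => w; rewrite indicI.
  rewrite mean_indic; last by apply: measurableI => //; exact: mG'.
  rewrite indep//; last exact: XG.
  rewrite fineM ?fin_num_measure//; last exact: mG'.
  under [in RHS]eq_fun do rewrite mulrC.
  rewrite meanZ ?mean_indic//.
  + by rewrite mulrC -(mean_indic P (mG' _ mB)).
  + exact: mG'.
  + by apply: bounded_mfun_indic; exact: mG'.
- by exists 1 => //=; exact: ler01.
Qed.

End sigma_process.

Section discretization.
Context {R : realType}.

(* The cap leaves finitely many values. *)
Definition grid_index (m : nat) (z : R) : nat :=
  minn (Num.truncn (m.+1%:R * z)) (m.+1 ^ 2).

(* The shift by [i.+1] steps puts the time strictly above [z] when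
   [k = grid_index m z], for [m] large, and turns nondecreasing sequences of
   times into increasing ones. *)
Definition grid_time (m i k : nat) : R := (k + i.+1)%:R / m.+1%:R.

Lemma le_grid_index m (y z : R) : y <= z ->
  (grid_index m y <= grid_index m z)%N.
Proof.
move=> yz; rewrite /grid_index leq_min geq_minr andbT geq_min le_truncn//.
by rewrite ler_wpM2l.
Qed.

Lemma grid_index_le m z : (grid_index m z <= m.+1 ^ 2)%N.
Proof. exact: geq_minr. Qed.

Lemma measurable_grid_index m k : measurable [set z | grid_index m z = k].
Proof.
have mf : measurable_fun setT (fun z => (grid_index m z)%:R : R).
  by apply: nondecreasing_measurable => // y z yz; rewrite ler_nat le_grid_index.
have := mf measurableT _ (measurable_set1 (k%:R : R)); rewrite setTI.
congr measurable; apply/seteqP; split=> z /=; last by move=> ->.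
by move/eqP; rewrite eqr_nat => /eqP.
Qed.

Lemma cvg_grid_time (f : R -> R) (z l : R) (i : nat) : 0 <= z ->
  f s @[s --> z^'+] --> l ->
  f (grid_time m i (grid_index m z)) @[m --> \oo] --> l.
Proof.
move=> z0 /cvg_at_rightP fl.
pose N := Num.truncn z; pose u (m : nat) : R := grid_time m i (grid_index m z).
(* After dropping N indices the number of steps per unit exceeds z, so floor((m+1) z) <= (m+1)^2 and
   the cap is inactive. *)
rewrite -(cvg_shiftn N (fun m => f (u m))).
have zN : z < N.+1%:R by exact: truncnS_gt.
have ub m : z < u (m + N)%N <= z + i.+1%:R * harmonic (m + N)%N.
  have mz0 : 0 <= (m + N).+1%:R * z by rewrite mulr_ge0.
  have /andP[t1 t2] := truncn_itv mz0.
  have zm : z <= (m + N).+1%:R.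
    by apply: le_trans (ltW zN) _; rewrite ler_nat ltnS leq_addl.
  rewrite /u; have -> : grid_index (m + N) z = Num.truncn ((m + N).+1%:R * z).
    apply/minn_idPl; rewrite -(ler_nat R); apply: le_trans t1 _.
    by rewrite natrX expr2 ler_wpM2l.
  rewrite /grid_time ltr_pdivlMr// ler_pdivrMr// mulrDl mulfVK//.
  move: t1 t2; set k := Num.truncn _; set p := (m + N).+1%:R.
  rewrite natrD -[k.+1%:R]natr1 -[i.+1%:R]natr1 => t1 t2.
  by have i0 := ler0n R i; apply/andP; split; lra.
apply: fl; split=> [m|]; first by have /andP[] := ub m.
apply: (@squeeze_cvgr _ _ _ _ (cst z) (fun m => z + i.+1%:R * harmonic (m + N)%N)).
- by near=> m; have /andP[/ltW -> ->] := ub m.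
- exact: cvg_cst.
- rewrite -[X in _ --> X]addr0 -[X in z + X](mulr0 i.+1%:R).
  apply: cvgD; first exact: cvg_cst.
  apply: cvgMl_tmp; rewrite (cvg_shiftn N (@harmonic R)); exact: cvg_harmonic.
Unshelve. all: by end_near. Qed.

End discretization.

Section partition.
Context {d : measure_display} {T : measurableType d} {R : realType}.
Variable P : probability T R.

(** The random index is frozen on each cell of a finite partition. Bounds are asked only after
    multiplication by the indicator, since [F a] need not be bounded when the index a is never
    attained. *)
Lemma mean_partition (K : finType) (k : T -> K) (F G : K -> T -> R) :
  let A a := k @^-1` [set a] in
  (forall a, bounded_mfun (fun w => F a w * \1_(A a) w)) ->
  (forall a, bounded_mfun (fun w => G a w * \1_(A a) w)) ->
  (forall a, mean P (fun w => F a w * \1_(A a) w) =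
             mean P (fun w => G a w * \1_(A a) w)) ->
  [/\ measurable_fun setT (fun w => F (k w) w),
      measurable_fun setT (fun w => G (k w) w) &
      mean P (fun w => F (k w) w) = mean P (fun w => G (k w) w)].
Proof.
move=> A bF bG FG.
have E (H : K -> T -> R) :
    (fun w => H (k w) w) = (fun w => \sum_a H a w * \1_(A a) w).
  apply/funext => w; rewrite (bigD1 (k w))//= indicE mem_set// mulr1.
  rewrite big1 ?addr0// => a ak; rewrite indicE memNset ?mulr0//.
  by move=> /= ka; rewrite ka eqxx in ak.
rewrite !E !mean_sum//; split.
- by apply: measurable_sum => a; case: (bF a).
- by apply: measurable_sum => a; case: (bG a).
- by apply: eq_bigr => a _; exact: FG.
Qed.

End partition.

Section time_change.
Context {d : measure_display} {T : measurableType d} {R : realType}.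
Variables (P : probability T R) (L eta : R -> T -> R) (phi : R -> R).
Hypothesis mL : forall t, 0 <= t -> measurable_fun setT (L t).
Hypothesis L_subordinator : subordinator P L.
Hypothesis L_laplace : forall x, 0 <= x ->
  mean P (fun w => expm x (L 1 w)) = expR (- phi x).
Hypothesis meta : forall t, 0 <= t -> measurable_fun setT (eta t).
Hypothesis eta_nd : nondecreasing_paths eta.
Hypothesis eta_ge0 : forall t w, 0 <= t -> 0 <= eta t w.
Hypothesis indep : independent_processes P L eta.

Let phi_ge0 := laplace_exponent_ge0 mL L_subordinator L_laplace.

(** The product is a single [expm 1 (G w)] with G a nonnegative combination of increments of L, so
    independence from A concerns one variable only; at constant times the mean of F is explicit. *)
Lemma mean_expm_increments_indic n (s : nat -> R) (x : 'I_n -> R) (A : set T) :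
  0 <= s 0%N -> (forall i, (i < n)%N -> s i < s i.+1) -> (forall i, 0 <= x i) ->
  sigma_process eta A ->
  let F w := \prod_i expm (x i) (L (s i.+1) w - L (s i) w) in
  bounded_mfun F /\
  mean P (fun w => F w * \1_A w) =
  mean P (fun w => \prod_i expm (phi (x i)) (s i.+1 - s i) * \1_A w).
Proof.
move=> s00 slt x0 eA F; have [_ _ L_nd _ _] := L_subordinator.
have s_ge0 := nneg_times s00 (fun i ni => ltW (slt i ni)).
have Z0 (i : 'I_n) w : 0 <= L (s i.+1) w - L (s i) w.
  rewrite subr_ge0; apply: L_nd; first by apply: s_ge0; exact: ltnW.
  by apply: ltW; exact: slt.
have mA : measurable A by exact: (sub_sigma_process meta).
pose G w := \sum_i x i * (L (s i.+1) w - L (s i) w).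
have FG : F = fun w => expm 1 (G w).
  by apply/funext => w; rewrite /F /expm mul1r /G -sumrN expR_sum.
have G0 w : 0 <= G w by apply: sumr_ge0 => i _; rewrite mulr_ge0.
have XG B : measurable B -> sigma_process L (G @^-1` B).
  apply: sigma_process_comp; apply: measurable_sum => i.
  apply: measurable_funM; first exact: measurable_cst.
  apply: measurable_funB; apply: measurable_sigma_process; apply: s_ge0 => //.
  exact: ltnW.
have bF : bounded_mfun F.
  rewrite FG; apply: bounded_mfun_comp => //.
    by move=> _ B mB; rewrite setTI; apply: (sub_sigma_process mL); exact: XG.
  exact: bounded_mfun_nneg_expm.
split=> //.
have -> : mean P (fun w => F w * \1_A w) = mean P (fun w => F w * fine (P A)).
  by rewrite FG; exact: (mean_expm_indic mL meta indep XG G0 eA).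
under eq_fun do rewrite mulrC.
rewrite (meanZ P (fine (P A)) bF).
have -> : mean P F = \prod_i expm (phi (x i)) (s i.+1 - s i).
  exact: (mean_expm_increments mL L_subordinator L_laplace s00 slt x0).
rewrite meanZ; last exact: bounded_mfun_indic.
by rewrite mean_indic// mulrC.
Qed.

Lemma cvg_prod_expm (I : finType) (x : I -> R) (u : nat -> I -> R) (l : I -> R) :
  (forall i, u n i @[n --> \oo] --> l i) ->
  \prod_i expm (x i) (u n i) @[n --> \oo] --> \prod_i expm (x i) (l i).
Proof.
move=> ul; rewrite [X in _ --> X](_ : _ = expR (- \sum_i x i * l i)); last first.
  by rewrite -sumrN expR_sum.
rewrite [X in X @ _](_ : _ = fun n => expR (- \sum_i x i * u n i)); last first.
  by apply/funext => n; rewrite -sumrN expR_sum.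
apply: cvg_expR; apply: cvgN; apply: cvg_big => [|i _].
  exact: add_continuous.
by apply: cvgMl_tmp; exact: ul.
Qed.

(** At grid times the identity holds cell by cell. The grid times approach those of [eta] from the
    right, where L converges for every w, and all products are bounded by 1. Equal times are allowed
    because stationarity includes h = 0. *)
Lemma mean_expm_time_change n (t : nat -> R) (x : 'I_n -> R) :
  0 <= t 0%N -> (forall i, (i < n)%N -> t i <= t i.+1) -> (forall i, 0 <= x i) ->
  mean P (fun w => \prod_i expm (x i)
    (time_change L eta (t i.+1) w - time_change L eta (t i) w)) =
  mean P (fun w => \prod_i expm (phi (x i)) (eta (t i.+1) w - eta (t i) w)).
Proof.
move=> t00 tle x0; have [L_cadlag _ L_nd _ _] := L_subordinator.
have t_ge0 := nneg_times t00 tle.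
pose K m := {ffun 'I_n.+1 -> 'I_(m.+1 ^ 2).+1}.
pose k m w : K m := [ffun i => inord (grid_index m (eta (t (i : 'I_n.+1)) w))].
pose s m (a : K m) (i : nat) : R := grid_time m i (a (inord i)).
have sk m w i : (i <= n)%N ->
    s m (k m w) i = grid_time m i (grid_index m (eta (t i) w)).
  by move=> ni; rewrite /s ffunE !inordK ?ltnS// grid_index_le.
have s0 m a i : 0 <= s m a i by rewrite divr_ge0.
(* Strictness is needed because [independent_increments] speaks of strictly increasing times, while
   [eta] may stay constant. *)
have slt m w i : (i < n)%N -> s m (k m w) i < s m (k m w) i.+1.
  move=> ni; rewrite !sk//; last exact: ltnW.
  rewrite ltr_pM2r ?invr_gt0// ltr_nat -addnS leq_add// le_grid_index//.
  by apply: eta_nd; [apply: t_ge0; exact: ltnW|exact: tle].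
pose F m (a : K m) w := \prod_(i < n) expm (x i) (L (s m a i.+1) w - L (s m a i) w).
pose G m (a : K m) (w : T) :=
  \prod_(i < n) expm (phi (x i)) (s m a i.+1 - s m a i).
have part m : [/\ measurable_fun setT (fun w => F m (k m w) w),
      measurable_fun setT (fun w => G m (k m w) w) &
      mean P (fun w => F m (k m w) w) = mean P (fun w => G m (k m w) w)].
  have eA a : sigma_process eta (k m @^-1` [set a]).
    rewrite (_ : _ @^-1` _ = \bigcap_(i in [set: 'I_n.+1])
        (eta (t i) @^-1` [set z | grid_index m z = a i])).
      apply: sigma_process_bigcap => i; apply: sub_sigma_algebra.
      exists (t i), [set z | grid_index m z = a i]; split=> //.
        by apply: t_ge0; rewrite -ltnS.
      exact: measurable_grid_index.
    apply/seteqP; split=> w /=.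
      by move=> <- i _ /=; rewrite ffunE inordK// ltnS grid_index_le.
    move=> h; apply/ffunP => i; apply/val_inj; rewrite ffunE/= inordK.
      exact: h.
    by rewrite ltnS grid_index_le.
  have mA a : measurable (k m @^-1` [set a]) by exact: (sub_sigma_process meta).
  have cell a : [/\ bounded_mfun (fun w => F m a w * \1_(k m @^-1` [set a]) w),
      bounded_mfun (fun w => G m a w * \1_(k m @^-1` [set a]) w) &
      mean P (fun w => F m a w * \1_(k m @^-1` [set a]) w) =
      mean P (fun w => G m a w * \1_(k m @^-1` [set a]) w)].
    (* For a vector never attained the times [s m a] may fail to increase, but its cell is empty and
       both sides vanish. *)
    have [[w kw]|A0] := pselect (exists w, k m w = a).
      have slta i : (i < n)%N -> s m a i < s m a i.+1 by rewrite -kw; exact: slt.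
      have [bF FG] := mean_expm_increments_indic (s0 m a 0%N) slta x0 (eA a).
      split=> //; first by apply: bounded_mfunM => //; exact: bounded_mfun_indic.
      by apply: bounded_mfunM; [exact: bounded_mfun_cst|exact: bounded_mfun_indic].
    have -> : k m @^-1` [set a] = set0.
      by apply/seteqP; split=> // w kw; apply: A0; exists w.
    have Z (H : T -> R) : (fun w => H w * \1_set0 w) = fun=> 0.
      by apply/funext => w; rewrite indic0 mulr0.
    by rewrite !Z; split=> //; exact: bounded_mfun_cst.
  by apply: mean_partition => a; have [] := cell a.
have prod01 (y z : 'I_n -> R) : (forall i, 0 <= y i) -> (forall i, 0 <= z i) ->
    `|\prod_i expm (y i) (z i)| <= 1.
  move=> y0 z0; rewrite ger0_norm; last by apply: prodr_ge0 => i _; exact: expm_ge0.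
  by apply: prodr_ile1 => i _; rewrite expm_ge0 expm_le1.
have [|||_ cF] := @bounded_cvg_mean _ _ _ P (fun m w => F m (k m w) w)
  (fun w => \prod_i expm (x i)
    (time_change L eta (t i.+1) w - time_change L eta (t i) w)) 1.
- by move=> m; have [] := part m.
- move=> m w; apply: prod01 => // i; rewrite subr_ge0; apply: L_nd => //.
  by apply: ltW; exact: slt.
- move=> w; apply: cvg_prod_expm => i.
  under eq_fun do rewrite !sk ?(ltnW (ltn_ord i))//.
  apply: cvgB; apply: (cvg_grid_time (f := fun s => L s w)).
  + exact/eta_ge0/t_ge0.
  + by apply: (L_cadlag _ _).1; exact/eta_ge0/t_ge0.
  + by apply/eta_ge0/t_ge0; exact: ltnW.
  + by apply: (L_cadlag _ _).1; apply/eta_ge0/t_ge0; exact: ltnW.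
have [|||_ cG] := @bounded_cvg_mean _ _ _ P (fun m w => G m (k m w) w)
  (fun w => \prod_i expm (phi (x i)) (eta (t i.+1) w - eta (t i) w)) 1.
- by move=> m; have [] := part m.
- move=> m w; apply: prod01 => i; first exact: phi_ge0.
  by rewrite subr_ge0; apply: ltW; exact: slt.
- move=> w; apply: cvg_prod_expm => i.
  under eq_fun do rewrite !sk ?(ltnW (ltn_ord i))//.
  apply: cvgB; apply: (cvg_grid_time (f := id)).
  + exact/eta_ge0/t_ge0.
  + by apply: cvg_at_right_filter; exact: cvg_id.
  + by apply/eta_ge0/t_ge0; exact: ltnW.
  + by apply: cvg_at_right_filter; exact: cvg_id.
apply: (cvg_unique _ cF) => //.
rewrite (_ : (fun m => mean P _) = fun m => mean P (fun w => G m (k m w) w))//.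
by apply/funext => m; have [_ _ ->] := part m.
Qed.

End time_change.

(** * Nondegeneracy of the exponent and transfer of increment properties *)

(** As 1 - e^{-v} is positive on ]0, +oo[, a vanishing integral forces nu to vanish there; together
    with gamma = 0 this is the excluded case. *)
Lemma laplace_exponent1_gt0 (R : realType) (gamma : R)
    (nu : {measure set R -> \bar R}) :
  0 <= gamma ->
  (\int[nu]_(s in `]0%R, +oo[) (Num.min 1 s)%:E < +oo)%E ->
  ~ (gamma = 0 /\ nu `]0, +oo[%classic = 0%E) ->
  - (gamma * 1) + \int[nu]_(v in `]0, +oo[) (expR (- (1 * v)) - 1) < 0.
Proof.
move=> g0 nufin nz.
set D := `]0, +oo[%classic.
have mD : measurable D by exact: measurable_itv.
pose f (v : R) := 1 - expR (- v).
have mf (E : set R) : measurable_fun E (EFin \o f).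
  apply/measurable_EFinP; apply: measurable_funB; first exact: measurable_cst.
  by apply: measurableT_comp => //; exact: measurable_funN.
have D0 v : D v -> 0 < v by rewrite /D/= in_itv/= andbT.
have f_gt0 v : D v -> 0 < f v.
  by move=> /D0 v0; rewrite /f subr_gt0 -expR0 ltr_expR oppr_lt0.
set J := (\int[nu]_(v in D) (f v)%:E)%E.
have J0 : (0 <= J)%E.
  by apply: integral_ge0 => v /f_gt0 /ltW; rewrite lee_fin.
(* [fine] sends +oo to 0, so [fine J = 0] yields J = 0 only for finite J. The bound 1 - e^{-v} <=
   min(1, v) reduces this to the Levy condition. *)
have Jfin : (J < +oo)%E.
  apply: le_lt_trans nufin; apply: ge0_le_integral => //.
  - by move=> v /f_gt0 /ltW; rewrite lee_fin.
  - by apply/measurable_EFinP; apply: measurable_minr.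
  - move=> v /D0 v0; rewrite lee_fin le_min; apply/andP; split.
      by rewrite /f gerBl expR_ge0.
    by have /andP[] := expRN_bounds (ltW v0).
have IE : \int[nu]_(v in D) (expR (- (1 * v)) - 1) = - fine J.
  rewrite /Rintegral -fineN; congr fine; rewrite -integral_ge0N; last first.
    by move=> v /f_gt0 /ltW; rewrite lee_fin.
  by apply: eq_integral => v _; rewrite /f -EFinN opprB mul1r.
rewrite IE mulr1 -opprD oppr_lt0.
have fJ0 : 0 <= fine J by exact: fine_ge0.
rewrite lt_def addr_ge0// andbT; apply/negP => /eqP gJ.
have gamma0 : gamma = 0 by lra.
have JE : J = 0%E.
  by rewrite -[J]fineK ?ge0_fin_numE//; congr EFin; lra.
apply: nz; split=> //.
have /(ae_eq_integral_abs nu mD (mf D)) fae :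
    (\int[nu]_(v in D) `|(EFin \o f) v| = 0)%E.
  rewrite -JE; apply: eq_integral => v /set_mem/f_gt0 fv.
  by rewrite gee0_abs// lee_fin ltW.
apply: measure_negligible => //.
apply: negligibleS fae => v Dv /(_ Dv) /= [] fv.
by have := f_gt0 v Dv; rewrite fv ltxx.
Qed.

Section time_change_increments.
Context {d : measure_display} {T : measurableType d} {R : realType}.
Variables (P : probability T R) (L eta : R -> T -> R) (phi : R -> R).
Hypothesis mL : forall t, 0 <= t -> measurable_fun setT (L t).
Hypothesis L_subordinator : subordinator P L.
Hypothesis L_laplace : forall x, 0 <= x ->
  mean P (fun w => expm x (L 1 w)) = expR (- phi x).
Hypothesis phi1 : 0 < phi 1.
Hypothesis meta : forall t, 0 <= t -> measurable_fun setT (eta t).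
Hypothesis eta_nd : nondecreasing_paths eta.
Hypothesis eta_ge0 : forall t w, 0 <= t -> 0 <= eta t w.
Hypothesis indep : independent_processes P L eta.

Local Notation N := (time_change L eta).

Let mN t : 0 <= t -> measurable_fun setT (N t).
Proof.
move=> t0; have [L_cadlag _ _ _ _] := L_subordinator.
apply: measurable_time_change => //; first exact: meta.
by move=> w; exact: eta_ge0.
Qed.

Let N_nd : nondecreasing_paths N.
Proof.
move=> w s t s0 st; have [_ _ L_nd _ _] := L_subordinator.
by apply: L_nd; [exact: eta_ge0|exact: eta_nd].
Qed.

Let m_incr (X : R -> T -> R) s t :
  (forall t, 0 <= t -> measurable_fun setT (X t)) -> 0 <= s -> s <= t ->
  measurable_fun setT (fun w => X t w - X s w).
Proof.
by move=> mX s0 st; apply: measurable_funB; apply: mX => //; exact: le_trans st.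
Qed.

Let incr_ge0 (X : R -> T -> R) s t w :
  nondecreasing_paths X -> 0 <= s -> s <= t -> 0 <= X t w - X s w.
Proof. by move=> X_nd s0 st; rewrite subr_ge0; exact: X_nd. Qed.

Let phi_ge0 := laplace_exponent_ge0 mL L_subordinator L_laplace.

Let phi_surj y : 0 <= y <= phi 1 -> exists x, 0 <= x /\ phi x = y.
Proof.
move=> y01.
have [x x0 xE] := laplace_exponent_surj mL L_subordinator L_laplace ler01 y01.
by exists x.
Qed.

Lemma mean_expm_time_change1 s t x : 0 <= s -> s <= t -> 0 <= x ->
  mean P (fun w => expm x (N t w - N s w)) =
  mean P (fun w => expm (phi x) (eta t w - eta s w)).
Proof.
move=> s0 st x0.
pose u (i : nat) := if i is 0%N then s else t.
have ule i : (i < 1)%N -> u i <= u i.+1 by case: i.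
have := mean_expm_time_change mL L_subordinator L_laplace meta eta_nd eta_ge0
  indep (t := u) s0 ule (x := fun=> x) (fun=> x0).
under eq_fun do rewrite big_ord1.
by under [in X in _ = X -> _]eq_fun do rewrite big_ord1.
Qed.

Let mean_factorizes_time_change n (t : nat -> R) (x : 'I_n -> R) :
  0 <= t 0%N -> (forall i, (i < n)%N -> t i < t i.+1) -> (forall i, 0 <= x i) ->
  mean_factorizes P (fun (i : 'I_n) w => N (t i.+1) w - N (t i) w)
    (fun i => expm (x i)) <->
  mean_factorizes P (fun (i : 'I_n) w => eta (t i.+1) w - eta (t i) w)
    (fun i => expm (phi (x i))).
Proof.
move=> t00 tlt x0.
have t_ge0 := nneg_times t00 (fun i ni => ltW (tlt i ni)).
rewrite /mean_factorizes (mean_expm_time_change mL L_subordinator L_laplace)//.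
  rewrite [X in _ = X <-> _](eq_bigr (fun i : 'I_n =>
    mean P (fun w => expm (phi (x i)) (eta (t i.+1) w - eta (t i) w))))// => i _.
  apply: mean_expm_time_change1 => //; first by apply: t_ge0; exact: ltnW.
  by apply: ltW; exact: tlt.
by move=> i ni; apply: ltW; exact: tlt.
Qed.

Lemma independent_increments_time_change :
  independent_increments P N <-> independent_increments P eta.
Proof.
split=> ind n t t00 tlt;
  have t_ge0 := nneg_times t00 (fun i ni => ltW (tlt i ni));
  have tin (i : 'I_n) : 0 <= t i /\ t i <= t i.+1 by
    split; [apply: t_ge0; exact: ltnW|apply: ltW; exact: tlt].
- apply: (expm_mutually_independent phi1) => [i|i w|y y01].
  + by have [? ?] := tin i; exact: m_incr.
  + by have [? ?] := tin i; exact: incr_ge0.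
  (* Lifting each exponent y i to some x i lets the factorization known for N cover a whole cube of
     exponents for [eta]. *)
  have /choice[x xE] i := phi_surj (y01 i).
  have -> : y = fun i => phi (x i) by apply/funext => i; have [_ ->] := xE i.
  have x0 i : 0 <= x i by have [] := xE i.
  apply/(mean_factorizes_time_change t00 tlt x0).
  apply: mutually_independent_expm => // [i|i w|].
  + by have [? ?] := tin i; exact: m_incr.
  + by have [? ?] := tin i; exact: incr_ge0.
  + exact: ind.
(* The bound 1 is arbitrary here: independence of the increments of [eta] factorizes at all
   nonnegative exponents, in particular at [phi (x i)]. *)
- apply: (expm_mutually_independent ltr01) => [i|i w|x x01].
  + by have [? ?] := tin i; exact: m_incr.
  + by have [? ?] := tin i; exact: incr_ge0.
  have x0 i : 0 <= x i by have /andP[] := x01 i.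
  apply/(mean_factorizes_time_change t00 tlt x0).
  apply: mutually_independent_expm => // [i|i w||i].
  + by have [? ?] := tin i; exact: m_incr.
  + by have [? ?] := tin i; exact: incr_ge0.
  + exact: ind.
  + exact: phi_ge0.
Qed.

Lemma stationary_increments_time_change :
  stationary_increments P N <-> stationary_increments P eta.
Proof.
have le0h (s h : R) : 0 <= h -> s <= s + h by move=> h0; rewrite lerDl.
split=> stat s h B s0 h0; move: B.
- apply: (eq_law_mean_expm phi1) => [||w|w|y /phi_surj[x [x0 <-]]].
  + by apply: m_incr => //; exact: le0h.
  + exact: m_incr.
  + by apply: incr_ge0 => //; exact: le0h.
  + exact: incr_ge0.
  apply: etrans (esym (mean_expm_time_change1 s0 (le0h s h h0) x0)) _.
  apply: etrans _ (mean_expm_time_change1 (lexx 0) h0 x0).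
  apply: mean_expm_eq_law x0 => [||w|w|B mB].
  + by apply: m_incr => //; exact: le0h.
  + exact: m_incr.
  + by apply: incr_ge0 => //; exact: le0h.
  + exact: incr_ge0.
  + exact: stat.
- apply: (eq_law_mean_expm ltr01) => [||w|w|x /andP[x0 _]].
  + by apply: m_incr => //; exact: le0h.
  + exact: m_incr.
  + by apply: incr_ge0 => //; exact: le0h.
  + exact: incr_ge0.
  apply: etrans (mean_expm_time_change1 s0 (le0h s h h0) x0) _.
  apply: etrans _ (esym (mean_expm_time_change1 (lexx 0) h0 x0)).
  apply: mean_expm_eq_law (phi_ge0 x0) => [||w|w|B mB].
  + by apply: m_incr => //; exact: le0h.
  + exact: m_incr.
  + by apply: incr_ge0 => //; exact: le0h.
  + exact: incr_ge0.
  + exact: stat.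
Qed.

End time_change_increments.

Theorem theorem2p4 (d : measure_display) (T : measurableType d) (R : realType)
    (P : probability T R)
    (eta L : R -> {RV P >-> R})
    (gamma : R) (nu : {measure set R -> \bar R})
    (eta_nondecreasing : nondecreasing_paths eta)
    (eta_cadlag : cadlag eta)
    (eta0 : forall w : T, eta 0 w = 0)
    (eta_cont : stochastically_continuous P eta)
    (L_subordinator : subordinator P L)
    (L_eta_independent : independent_processes P L eta)
    (gamma_ge0 : 0 <= gamma)
    (nu_support : nu `]-oo, 0]%classic = 0%E)
    (nu_levy : (\int[nu]_(s in `]0%R, +oo[) (Num.min 1 s)%:E < +oo)%E)
    (L_laplace : forall x : R, 0 <= x ->
      'E_P[fun w => expR (- (x * L 1 w))%R]%E =
      (expR (- (gamma * x) +
             \int[nu]_(v in `]0, +oo[) (expR (- (x * v)) - 1)))%:E)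
    (L_nonzero : ~ (gamma = 0 /\ nu `]0, +oo[%classic = 0%E)) :
  (independent_increments P (time_change L eta) <->
     independent_increments P eta) /\
  ((stationary_increments P (time_change L eta) /\
    independent_increments P (time_change L eta)) <->
     subordinator P eta).
Proof.
pose phi x := - (- (gamma * x) + \int[nu]_(v in `]0, +oo[) (expR (- (x * v)) - 1)).
have L_mean x : 0 <= x -> mean P (fun w => expm x (L 1 w)) = expR (- phi x).
  move=> x0; have := congr1 fine (L_laplace x x0); rewrite /phi opprK /= => <-.
  by rewrite meanE unlock.
have phi1 : 0 < phi 1 by rewrite oppr_gt0; exact: laplace_exponent1_gt0.
have mX (X : R -> {RV P >-> R}) t : 0 <= t -> measurable_fun setT (X t).
  by move=> _; exact: measurable_funP.
have eta_ge0 t w : 0 <= t -> 0 <= eta t w.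
  by move=> t0; rewrite -(eta0 w); exact: eta_nondecreasing.
have ind := independent_increments_time_change (mX L) L_subordinator L_mean phi1
  (mX eta) eta_nondecreasing eta_ge0 L_eta_independent.
have stat := stationary_increments_time_change (mX L) L_subordinator L_mean phi1
  (mX eta) eta_nondecreasing eta_ge0 L_eta_independent.
(* The other clauses of [subordinator] for [eta] are hypotheses, [eta 0 w = 0] holding for every w
   and hence almost everywhere. *)
split=> //; split=> [[/stat ? /ind ?]|[_ _ _ _ [? ?]]].
  by split=> //; exact: aeW.
by split; [exact/stat|exact/ind].
Qed.
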